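(* Let $H$ be a real polynomial in two variables, $h\in\mathbb{R}$, $i,j\ge 0$ integers, $\Gamma_h\subset H^{-1}(h)$ an oval with interior $D_h$, and $B^0$ a trapping box for $\Gamma_h$. Let $\mathcal{B}$ be a finite subdivision of $B^0$ into boxes, each labelled inside, outside, on, or fail, according to the labelling rules in the context. Suppose that for every box labelled on, the following three conditions hold (with the notation of the context attached to that box): (1) $\operatorname{sign}(H(p_{up})-h)=\operatorname{sign}(H(q_{up})-h)=-\operatorname{sign}(H(p_{down})-h)=-\operatorname{sign}(H(q_{down})-h)$; (2) $0\notin H(l_{up})-h$ and $0\notin H(l_{down})-h$; (3) $\Gamma_h\cap S_1=\emptyset$ and $\Gamma_h\cap S_2=\emptyset$, where $S_1,S_2$ are the two sides of the box other than its sides right and left. Then the Abelian integral $$I_{ij}(h)=\int_{D_h}x^iy^j\,dx\wedge dy$$ is enclosed as follows (sums and products being those of interval arithmetic): $$I_{ij}(h)\in\sum_{B\in\mathrm{inside}}J(B)+\sum_{T\in\mathrm{inside}}(\Box T)_1^{\,i}\,(\Box T)_2^{\,j}\,|T|+\sum_{B\in\mathrm{fail}}\mathrm{Hull}\bigl(0,\tilde J(B)\bigr)+\sum_{P\in\mathrm{on}}\mathrm{Hull}\bigl(0,(\Box P)_1^{\,i}\,(\Box P)_2^{\,j}\,|P|\bigr).$$ Here the first sum runs over all boxes labelled inside (the boxes of $\mathcal{B}$ labelled inside, and the boxes labelled inside that arise from splitting boxes labelled on), the second over all triangles labelled inside that arise from splitting boxes labelled on, the third over all boxes of $\mathcal{B}$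 labelled fail, and the fourth over the quadrilaterals $P$ of all boxes labelled on.
   Context: **Oval and trapping box.** A box is a product $B=B_1\times B_2\subset\mathbb{R}^2$ of compact intervals. An oval $\Gamma_h$ is a compact level curve component of $H$ at level $h$ (a simple closed curve contained in $H^{-1}(h)$), and $D_h$ is the bounded open region it encloses. A trapping box $B^0$ for $\Gamma_h$ is a box containing $\Gamma_h\cup D_h$ such that, within $B^0$, one has $H<h$ exactly on $D_h$, $H=h$ exactly on $\Gamma_h$, and $H>h$ on the rest of $B^0$. **Interval notation.** For a set $S$, $H(S)=\{H(z):z\in S\}$. For a bounded set $S\subset\mathbb{R}^2$, $\Box S=(\Box S)_1\times(\Box S)_2$ is the smallest box containing $S$, and $|S|$ is its area. For an interval $X$, $X^k=\{x^k:x\in X\}$ (with $X^0=\{1\}$). Sums and products of intervals are the sets of all sums and products of elements. A real number is identified with a one-point interval. $\mathrm{Hull}(0,X)$ is the smallest interval containing $0$ and $X$. **Subdivision and labels.** $\mathcal{B}$ is a finite set of boxes with union $B^0$ and pairwise disjoint interiors. Each $B\in\mathcal{B}$ has exactly one label: - inside: only if $H<h$ on all of $B$. - outside: only if $H>h$ on all of $B$. Such boxes do not contribute. - on: $B$ comes with the data described below. - fail: used for the remaining boxes, i.e. small boxes for which neither intersection nor non-intersection with $\Gamma_h$ has been established. Nothing is assumed about them. **Data of a box $B$ labelled on.** Two different sides of $B$, called right and left, are given, such that $H-h$ has exactly one zero on the side right and exactly one zero on the side left. A point $p$ on the side right and a point $q$ on the side left (numerical approximations of these zeros) and a number $a>0$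 (the accuracy) are given. The points $p_{up},p_{down}$ are the two points of the side right at distance $a$ from $p$, one on each side of $p$. The points $q_{up},q_{down}$ are the two points of the side left at distance $a$ from $q$, one on each side of $q$. They are named so that the segments $l_{up}=[p_{up},q_{up}]$ and $l_{down}=[p_{down},q_{down}]$ do not cross. Let $P$ be the quadrilateral (called ''parallelepiped'' in the source) with vertices $p_{up},q_{up},q_{down},p_{down}$, i.e. the region of $B$ between $l_{up}$ and $l_{down}$. The box $B$ is split into five parts with pairwise disjoint interiors: $P$, two triangles $T_l,T_u$ and two axis-parallel boxes $B_l,B_u$ (possibly degenerate), where the triangles and boxes together fill the closure of $B\setminus P$ and each of them lies in the closure of a single connected component of $B\setminus P$. Each of $T_l,T_u,B_l,B_u$ is labelled inside if $H<h$ at one chosen point of it, and outside if $H>h$ at that point. Pieces labelled outside do not contribute. **Integral over a box.** For a box $B=B_1\times B_2$, $$J(B)=\int_Bx^iy^j\,dx\wedge dy=\left(\frac{(\sup B_1)^{i+1}}{i+1}-\frac{(\inf B_1)^{i+1}}{i+1}\right)\left(\frac{(\sup B_2)^{j+1}}{j+1}-\frac{(\inf B_2)^{j+1}}{j+1}\right).$$ **Modified integral for boxes labelled fail.** $\tilde J(B)=X\cdot Y$ (interval product), where - if $0\in B_1$ and $i$ is odd, $X=[-c,c]$ with $c=\frac{(\sup B_1)^{i+1}}{i+1}+\frac{(\inf B_1)^{i+1}}{i+1}$; otherwise $X=\frac{(\sup B_1)^{i+1}}{i+1}-\frac{(\inf B_1)^{i+1}}{i+1}$; - if $0\in B_2$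 and $j$ is odd, $Y=[-d,d]$ with $d=\frac{(\sup B_2)^{j+1}}{j+1}+\frac{(\inf B_2)^{j+1}}{j+1}$; otherwise $Y=\frac{(\sup B_2)^{j+1}}{j+1}-\frac{(\inf B_2)^{j+1}}{j+1}$. *)

(* Defs.v *)
From HB Require Import structures.
From mathcomp Require Import all_boot all_order all_algebra.
From mathcomp Require Import all_classical all_reals all_analysis.

Set Implicit Arguments.
Unset Strict Implicit.
Unset Printing Implicit Defensive.

Import Order.TTheory GRing.Theory Num.Theory.
Import numFieldNormedType.Exports.
Local Open Scope classical_set_scope.
Local Open Scope ring_scope.

(* A real polynomial in two variables is an element of {poly {poly R}}, with
   the evaluation p.[x, y] of polyXY. *)
Definition ev (R : realType) (H : {poly {poly R}}) (z : R * R) : R :=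
  H.[z.1, z.2].

Definition leb2 (R : realType) :=
  (@lebesgue_measure R \x @lebesgue_measure R)%E.

Definition area (R : realType) (S : set (R * R)) : R := fine (@leb2 R S).

Definition edist (R : realType) (p q : R * R) : R :=
  Num.sqrt ((p.1 - q.1) ^+ 2 + (p.2 - q.2) ^+ 2).

Definition conv (R : realType) (S : set (R * R)) : set (R * R) :=
  smallest (fun A : set (R * R) => convex_set (A : set (R^o * R^o))) S.

Definition segment (R : realType) (p q : R * R) : set (R * R) :=
  [set ((1 - t) * p.1 + t * q.1, (1 - t) * p.2 + t * q.2)
     | t in `[0 : R, 1]].

(* Interval arithmetic, on sets of reals.  A real r is the set [set r]. *)
Definition iadd (R : realType) (X Y : set R) : set R :=
  [set x + y | x in X & y in Y].

Definition imul (R : realType) (X Y : set R) : set R :=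
  [set x * y | x in X & y in Y].

Definition ipow (R : realType) (X : set R) (k : nat) : set R :=
  [set x ^+ k | x in X].

Definition hull0 (R : realType) (X : set R) : set R :=
  smallest (@is_interval R) (0 |` X).

Record box (R : realType) := Box {
  lo1 : R; hi1 : R; lo2 : R; hi2 : R;
  box_le1 : lo1 <= hi1;
  box_le2 : lo2 <= hi2 }.

Definition box_set (R : realType) (B : box R) : set (R * R) :=
  `[lo1 B, hi1 B]%classic `*` `[lo2 B, hi2 B]%classic.

Definition bbox (R : realType) (S : set (R * R)) : set (R * R) :=
  smallest [set A | exists B : box R, A = box_set B] S.

Definition bbox1 (R : realType) (S : set (R * R)) : set R := fst @` bbox S.
Definition bbox2 (R : realType) (S : set (R * R)) : set R := snd @` bbox S.

Inductive side := Xmin | Xmax | Ymin | Ymax.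

Definition side_set (R : realType) (B : box R) (s : side) : set (R * R) :=
  match s with
  | Xmin => [set lo1 B] `*` `[lo2 B, hi2 B]%classic
  | Xmax => [set hi1 B] `*` `[lo2 B, hi2 B]%classic
  | Ymin => `[lo1 B, hi1 B]%classic `*` [set lo2 B]
  | Ymax => `[lo1 B, hi1 B]%classic `*` [set hi2 B]
  end.

Definition simple_closed_curve (R : realType) (G : set (R * R)) : Prop :=
  exists g : R -> R * R,
    [/\ {within `[0, 1], continuous g},
        {in `[0, 1[ &, injective g},
        g 0 = g 1 & G = g @` `[0, 1]].

Definition level_set (R : realType) (H : {poly {poly R}}) (h : R) :
  set (R * R) := [set z | ev H z = h].

Definition is_oval (R : realType) (H : {poly {poly R}}) (h : R)
    (G : set (R * R)) : Prop :=
  [/\ exists2 z, level_set H h z & G = connected_component (level_set H h) z,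
      compact G & simple_closed_curve G].

(* The bounded component of the complement of G; the Jordan curve theorem gives
   exactly one when G is a simple closed curve.  The condition ~ G z is needed
   because connected_component A z is empty, hence bounded, when z is not
   in A. *)
Definition oval_interior (R : realType) (G : set (R * R)) : set (R * R) :=
  [set z | ~ G z /\ bounded_set (connected_component (~` G) z)].

Definition trapping_box (R : realType) (H : {poly {poly R}}) (h : R)
    (G : set (R * R)) (B0 : box R) : Prop :=
  G `|` oval_interior G `<=` box_set B0 /\
  (forall z, box_set B0 z ->
     [/\ ev H z < h <-> oval_interior G z,
         ev H z = h <-> G z
       & ev H z > h <-> ~ G z /\ ~ oval_interior G z]).

Definition subdivision (R : realType) (B0 : box R) (n : nat)
    (B : 'I_n -> box R) : Prop :=
  \bigcup_k box_set (B k) = box_set B0 /\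
  trivIset setT (fun k => (box_set (B k))°).

(* Indices false and true stand for the subscripts l and u. *)
Record on_data (R : realType) := OnData {
  right_side : side;  left_side : side;
  pp : R * R;  qq : R * R;  acc : R;
  p_up : R * R;  p_down : R * R;  q_up : R * R;  q_down : R * R;
  tri : bool -> (R * R) * (R * R) * (R * R);
  sub : bool -> box R;
  tri_point : bool -> R * R;  tri_inside : bool -> bool;
  sub_point : bool -> R * R;  sub_inside : bool -> bool }.

Definition tri_set (R : realType) (t : (R * R) * (R * R) * (R * R)) :
  set (R * R) := conv [set t.1.1; t.1.2; t.2].

Definition l_up (R : realType) (d : on_data R) : set (R * R) :=
  segment (p_up d) (q_up d).
Definition l_down (R : realType) (d : on_data R) : set (R * R) :=
  segment (p_down d) (q_down d).
Definition quad (R : realType) (d : on_data R) : set (R * R) :=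
  conv [set p_up d; q_up d; q_down d; p_down d].

Definition split_pieces (R : realType) (d : on_data R) : seq (set (R * R)) :=
  [:: tri_set (tri d false); tri_set (tri d true);
      box_set (sub d false); box_set (sub d true)].

(* If the quadrilateral is the whole box, then B \ P has no component and the
   four pieces, contained in B and with interiors disjoint from that of P, are
   degenerate. *)
Definition valid_split (R : realType) (B : box R) (d : on_data R) : Prop :=
  let BP := box_set B `\` quad d in
  [/\ trivIset `I_5 (fun m => (nth set0 (quad d :: split_pieces d) m)°),
      \bigcup_(m in `I_5) nth set0 (quad d :: split_pieces d) m = box_set B
    & BP !=set0 ->
      \bigcup_(m in `I_4) nth set0 (split_pieces d) m = closure BP /\
      (forall m, (m < 4)%N -> exists2 z, BP z &
         nth set0 (split_pieces d) m `<=`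
           closure (connected_component BP z))].

Definition valid_piece_label (R : realType) (H : {poly {poly R}}) (h : R)
    (S : set (R * R)) (c : R * R) (inside : bool) : Prop :=
  S c /\ (if inside then ev H c < h else ev H c > h).

Record valid_on (R : realType) (H : {poly {poly R}}) (h : R) (B : box R)
    (d : on_data R) : Prop := ValidOn {
  on_sides : right_side d <> left_side d;
  on_right : exists! z, side_set B (right_side d) z /\ ev H z - h = 0;
  on_left : exists! z, side_set B (left_side d) z /\ ev H z - h = 0;
  on_p : side_set B (right_side d) (pp d);
  on_q : side_set B (left_side d) (qq d);
  on_acc : 0 < acc d;
  on_p_up : side_set B (right_side d) (p_up d) /\
            edist (pp d) (p_up d) = acc d;
  on_p_down : side_set B (right_side d) (p_down d) /\
              edist (pp d) (p_down d) = acc d;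
  on_p_between : segment (p_up d) (p_down d) (pp d);
  on_q_up : side_set B (left_side d) (q_up d) /\
            edist (qq d) (q_up d) = acc d;
  on_q_down : side_set B (left_side d) (q_down d) /\
              edist (qq d) (q_down d) = acc d;
  on_q_between : segment (q_up d) (q_down d) (qq d);
  on_no_cross : l_up d `&` l_down d = set0;
  on_split : valid_split B d;
  on_tri_label : forall e,
    valid_piece_label H h (tri_set (tri d e)) (tri_point d e) (tri_inside d e);
  on_sub_label : forall e,
    valid_piece_label H h (box_set (sub d e)) (sub_point d e) (sub_inside d e)
}.

Inductive label (R : realType) :=
  | Inside | Outside | On of on_data R | Fail.
Arguments Inside {R}.
Arguments Outside {R}.
Arguments Fail {R}.

Definition valid_label (R : realType) (H : {poly {poly R}}) (h : R)
    (B : box R) (lb : label R) : Prop :=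
  match lb with
  | Inside => forall z, box_set B z -> ev H z < h
  | Outside => forall z, box_set B z -> ev H z > h
  | On d => valid_on H h B d
  | Fail => True
  end.

Definition cond_signs (R : realType) (H : {poly {poly R}}) (h : R)
    (d : on_data R) : Prop :=
  [/\ Num.sg (ev H (p_up d) - h) = Num.sg (ev H (q_up d) - h),
      Num.sg (ev H (q_up d) - h) = - Num.sg (ev H (p_down d) - h)
    & - Num.sg (ev H (p_down d) - h) = - Num.sg (ev H (q_down d) - h)].

Definition cond_segments (R : realType) (H : {poly {poly R}}) (h : R)
    (d : on_data R) : Prop :=
  ~ [set ev H z - h | z in l_up d] 0 /\ ~ [set ev H z - h | z in l_down d] 0.

Definition cond_other_sides (R : realType) (G : set (R * R)) (B : box R)
    (d : on_data R) : Prop :=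
  forall s, s <> right_side d -> s <> left_side d ->
    G `&` side_set B s = set0.

Definition monomial (R : realType) (i j : nat) (z : R * R) : R :=
  z.1 ^+ i * z.2 ^+ j.

Definition abelian_integral (R : realType) (i j : nat) (G : set (R * R)) : R :=
  \int[@leb2 R]_(z in oval_interior G) monomial i j z.

Definition J (R : realType) (i j : nat) (B : box R) : R :=
  (hi1 B ^+ i.+1 / i.+1%:R - lo1 B ^+ i.+1 / i.+1%:R) *
  (hi2 B ^+ j.+1 / j.+1%:R - lo2 B ^+ j.+1 / j.+1%:R).

Definition Jt_factor (R : realType) (k : nat) (lo hi : R) : set R :=
  let c := hi ^+ k.+1 / k.+1%:R + lo ^+ k.+1 / k.+1%:R in
  if (lo <= 0 <= hi) && odd k then `[- c, c]%classic
  else [set hi ^+ k.+1 / k.+1%:R - lo ^+ k.+1 / k.+1%:R].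

Definition Jt (R : realType) (i j : nat) (B : box R) : set R :=
  imul (Jt_factor i (lo1 B) (hi1 B)) (Jt_factor j (lo2 B) (hi2 B)).

Definition bbox_term (R : realType) (i j : nat) (S : set (R * R)) : set R :=
  imul (imul (ipow (bbox1 S) i) (ipow (bbox2 S) j)) [set area S].

Definition sum_boxes (R : realType) (i j n : nat) (B : 'I_n -> box R)
    (lab : 'I_n -> label R) : set R :=
  \big[@iadd R/[set 0]]_(k < n)
    match lab k with
    | Inside => [set J i j (B k)]
    | On d => \big[@iadd R/[set 0]]_(e : bool | sub_inside d e)
                [set J i j (sub d e)]
    | _ => [set 0]
    end.

Definition sum_triangles (R : realType) (i j n : nat)
    (lab : 'I_n -> label R) : set R :=
  \big[@iadd R/[set 0]]_(k < n)
    if lab k is On d then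
      \big[@iadd R/[set 0]]_(e : bool | tri_inside d e)
        bbox_term i j (tri_set (tri d e))
    else [set 0].

Definition sum_fail (R : realType) (i j n : nat) (B : 'I_n -> box R)
    (lab : 'I_n -> label R) : set R :=
  \big[@iadd R/[set 0]]_(k < n)
    if lab k is Fail then hull0 (Jt i j (B k)) else [set 0].

Definition sum_on (R : realType) (i j n : nat) (lab : 'I_n -> label R) :
  set R :=
  \big[@iadd R/[set 0]]_(k < n)
    if lab k is On d then hull0 (bbox_term i j (quad d)) else [set 0].

(* Main.v *)
Require Import Defs.
From mathcomp Require Import all_boot all_order all_algebra.
From mathcomp Require Import all_classical all_reals all_analysis.
From mathcomp Require Import ring lra.

Set Implicit Arguments.
Unset Strict Implicit.
Unset Printing Implicit Defensive.

Import Order.TTheory GRing.Theory Num.Theory.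
Import numFieldNormedType.Exports.
Local Open Scope classical_set_scope.
Local Open Scope ring_scope.

(** On the trapping box the interior of the oval is the sublevel set
    [D = {H < h}], so the Abelian integral is the integral of the monomial over
    [D] intersected with the box.  As [H - h] is not the zero polynomial
    ([level_poly_neq0]), the level set is null ([zero_set_null]).  The boundary
    of a convex set is null too ([convex_boundary_null]), so this integral is the sum of the integrals over
    the parts of [D] in the tiles ([Rintegral_tiles]).  Inside and outside boxes
    then contribute exactly, and the contribution of a fail box is controlled by
    the integral of the absolute value of the monomial ([hull0_Jt_Rintegral]).

    The heart of the matter is a box [B] labelled on, with quadrilateral [P].
    The sign conditions put the unique zeros on the right and left sides inside
    [P] ([right_zero_quad], [left_zero_quad]), the two other sides do not meet
    the oval, and the segments [l_up] and [l_down] carry no zero.  Relative to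
    [B] the quadrilateral is bounded by these two segments alone ([quad_nbhs]).
    Hence the part of the oval in [B] outside [P] is open and closed in the
    oval.  As the oval is connected and meets [P], that part is empty
    ([no_zero_outside_quad]), and [H - h] keeps its sign on each component of
    [B] minus [P].  The sign at one chosen point therefore decides the sign on
    a whole piece ([piece_integral]).

    A triangle in [D] is then evaluated by the mean value theorem
    ([bbox_term_Rintegral]); on [P], where only an unknown part belongs to [D],
    the same bounds are weakened by the hull with [0]
    ([hull0_bbox_term_Rintegral]). *)

(** * Measurable and null sets of the plane *)

(** The product of two copies of the line with the sigma-algebra that carries
    the Lebesgue measure. *)
Notation plane R := (measurableTypeR R * measurableTypeR R)%type.

Section Plane.
Variable R : realType.
Implicit Types (p q z : R * R) (S A : set (R * R)) (B : box R).

Lemma nbhs_plane z A : nbhs z A <->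
  exists2 e : R, 0 < e &
    forall w, `|z.1 - w.1| < e -> `|z.2 - w.2| < e -> A w.
Proof.
rewrite nbhs_ballP; split.
  by move=> [e /= e0 He]; exists e => // w w1 w2; apply: He; split.
by move=> [e e0 He]; exists e => //= w [w1 w2]; apply: He.
Qed.

Lemma open_measurable_plane A : open A -> measurable (A : set (plane R)).
Proof.
move=> oA.
pose rect (q : (rat * rat) * (rat * rat)) : set (plane R) :=
  `]ratr q.1.1, ratr q.1.2[%classic `*` `]ratr q.2.1, ratr q.2.2[%classic.
(* an open set is the union of the rational rectangles that it contains *)
have -> : A = \bigcup_(q in [set q | rect q `<=` A]) rect q.
  apply/seteqP; split=> [z Az|z [q /= qA]]; last exact: qA.
  have /nbhs_plane[e e0 He] : nbhs z A by apply: open_nbhs_nbhs; split.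
  have ltl (x : R) : x - e < x by rewrite ltrBlDr ltrDl.
  have ltr (x : R) : x < x + e by rewrite ltrDl.
  have [a1 a1P] := rat_in_itvoo (ltl z.1).
  have [a2 a2P] := rat_in_itvoo (ltr z.1).
  have [b1 b1P] := rat_in_itvoo (ltl z.2).
  have [b2 b2P] := rat_in_itvoo (ltr z.2).
  move: a1P a2P b1P b2P; rewrite !in_itv/= => /andP[? ?] /andP[? ?] /andP[? ?]
    /andP[? ?].
  exists ((a1, a2), (b1, b2)); last first.
    by split; rewrite /= in_itv/=; apply/andP; split.
  move=> w [/=]; rewrite !in_itv/= => /andP[? ?] /andP[? ?].
  by apply: He; rewrite ltr_norml; apply/andP; split; lra.
rewrite bigcup_mkcond; apply: countable_bigcupT_measurable => // q.
case: ifPn => // _; apply: measurableX; exact: measurable_itv.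
Qed.

Lemma closed_measurable_plane A : closed A -> measurable (A : set (plane R)).
Proof.
by move=> /closed_openC/open_measurable_plane/measurableC; rewrite setCK.
Qed.

(** By Fubini, as countable sets are null on the line.  Level curves and
    boundaries of convex sets are recognised as null sets in this way. *)
Lemma leb2_null (A : set (plane R)) (N : set R) : measurable A ->
  countable N -> (forall x, ~ N x -> countable (xsection A x)) ->
  leb2 A = 0%E.
Proof.
move=> mA cN cA; rewrite /leb2 /product_measure1.
have mphi := measurable_fun_xsection (@lebesgue_measure R) mA.
rewrite (ge0_ae_eq_integral (g := cst 0%E)) ?integral0//.
exists N; split.
- by apply: countable_measurable => // t; exact: measurable_set1.
- exact: countable_lebesgue_measure0.
- move=> x /= Hx; apply: contrapT => Nx; apply: Hx => _ /=.
  exact/countable_lebesgue_measure0/cA.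
Qed.

End Plane.

(** * Convex hulls of finitely many points *)

Section Convex.
Variable R : realType.
Implicit Types (p q z : R * R) (S K : set (R * R)) (s t : R).

(** The barycentre whose trajectory is [segment p q]. *)
Definition bary t p q : R * R :=
  ((1 - t) * p.1 + t * q.1, (1 - t) * p.2 + t * q.2).

(** Convexity with weights that are plain reals, on which arithmetic tactics
    work. *)
Definition convex2 S := forall p q t, S p -> S q -> 0 <= t <= 1 ->
  S (bary t p q).

Lemma convex_setE S : convex_set (S : set (R^o * R^o)) <-> convex2 S.
Proof.
split=> cS.
  move=> p q t Sp Sq /andP[t0 t1].
  have t0' : 0 <= 1 - t by rewrite subr_ge0.
  have t1' : 1 - t <= 1 by rewrite lerBlDr lerDl.
  have := cS p q (Itv01 t0' t1').
  rewrite !inE => /(_ Sp Sq); congr S.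
  by rewrite /convex.conv/= /bary/= /unstable.onem subKr.
move=> p q t; rewrite !inE => Sp Sq.
have -> : convex.conv t p q = bary (1 - t%:num) p q.
  by rewrite /convex.conv/= /bary/= /unstable.onem subKr.
by apply: cS => //; rewrite subr_ge0 lerBlDr lerDl; apply/andP.
Qed.

Lemma convex_conv S : convex2 (Defs.conv S).
Proof.
apply/convex_setE => p q t; rewrite !inE => Sp Sq A [cA SA].
have [Ap Aq] : A p /\ A q by split; [exact: Sp|exact: Sq].
by have := cA p q t; rewrite !inE; apply.
Qed.

Lemma conv_sub S K : convex2 K -> S `<=` K -> Defs.conv S `<=` K.
Proof. by move=> /convex_setE cK SK; apply: smallest_sub. Qed.

Lemma sub_conv S : S `<=` Defs.conv S.
Proof. exact: sub_gen_smallest. Qed.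

Lemma convex_box (B : box R) : convex2 (box_set B).
Proof.
move=> p q t [/=]; rewrite !in_itv/= => /andP[? ?] /andP[? ?].
move=> [/=]; rewrite !in_itv/= => /andP[? ?] /andP[? ?] /andP[? ?].
by split; rewrite /= in_itv/=; apply/andP; split; nra.
Qed.

Definition cone p K := [set bary s.1 p s.2 | s in `[0 : R, 1] `*` K].

(** The weight [0] on [K] leaves the apex alone; otherwise the two base points
    are merged with the weights renormalised. *)
Lemma convex_cone p K : convex2 K -> convex2 (cone p K).
Proof.
move=> cK _ _ t [[s k] /= [+ Kk] <-] [[s' k'] /= [+ Kk'] <-] /andP[t0 t1].
rewrite !in_itv/= => /andP[s0 s1] /andP[s0' s1'].
pose w := (1 - t) * s + t * s'.
have a0 : 0 <= (1 - t) * s by rewrite mulr_ge0// subr_ge0.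
have b0 : 0 <= t * s' by rewrite mulr_ge0.
have w01 : 0 <= w <= 1 by rewrite /w; apply/andP; split; nra.
have [w0|wn0] := eqVneq w 0.
  exists (0, k) => /=; first by split => //=; rewrite in_itv/= lexx ler01.
  have [e1 e2] : (1 - t) * s = 0 /\ t * s' = 0
    by move: w0 => /eqP; rewrite /w paddr_eq0// => /andP[/eqP ? /eqP ?].
  have split_apex (x y y' : R) : (1 - t) * ((1 - s) * x + s * y) +
      t * ((1 - s') * x + s' * y') =
      x + (1 - t) * s * (y - x) + t * s' * (y' - x) by ring.
  by rewrite /bary/=; congr pair; rewrite split_apex e1 e2; ring.
exists (w, bary (t * s' / w) k k') => /=.
  have w_gt0 : 0 < w by rewrite lt_neqAle eq_sym wn0; case/andP: w01.
  split => //=; apply: cK => //; rewrite divr_ge0 ?(ltW w_gt0)//=.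
  by rewrite ler_pdivrMr// mul1r /w lerDr.
by rewrite /bary/=; congr pair; rewrite /w; field; exact: wn0.
Qed.

Lemma continuous_plane (T : topologicalType) (f g : T -> R) :
  continuous f -> continuous g -> continuous (fun x => (f x, g x) : R * R).
Proof. by move=> cf cg x; apply: (cvg_pair (cf x) (cg x)). Qed.

Lemma bary_continuous p :
  continuous (fun s : R * (R * R) => bary s.1 p s.2 : R * R).
Proof.
have c1 : continuous (fun s : R * (R * R) => s.1) by move=> s; exact: cvg_fst.
have c2 : continuous (fun s : R * (R * R) => s.2) by move=> s; exact: cvg_snd.
have onem_c (a : R) : continuous (fun s : R * (R * R) => (1 - s.1) * a).
  by move=> s; apply: cvgM;
    [apply: cvgB; [exact: cvg_cst|exact: c1]|exact: cvg_cst].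
have c21 : continuous (fun s : R * (R * R) => s.2.1).
  by move=> s; apply: (continuous_comp (c2 s)); exact: cvg_fst.
have c22 : continuous (fun s : R * (R * R) => s.2.2).
  by move=> s; apply: (continuous_comp (c2 s)); exact: cvg_snd.
apply: continuous_plane => s; apply: cvgD; try exact: onem_c.
- by apply: cvgM; [exact: c1|exact: c21].
- by apply: cvgM; [exact: c1|exact: c22].
Qed.

Lemma compact_cone p K : compact K -> compact (cone p K).
Proof.
move=> cK; apply: continuous_compact.
  exact/continuous_subspaceT/bary_continuous.
by apply: compact_setX => //; exact: segment_compact.
Qed.

Lemma bary0 p q : bary 0 p q = p.
Proof. by case: p => ? ?; rewrite /bary/= subr0 !mul1r !mul0r !addr0. Qed.

Lemma bary1 p q : bary 1 p q = q.
Proof. by case: q => ? ?; rewrite /bary/= subrr !mul1r !mul0r !add0r. Qed.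

(** One point at a time, this exhibits a hull of finitely many points as the
    continuous image of a compact set. *)
Lemma conv_setU1 S p : S !=set0 ->
  Defs.conv (S `|` [set p]) = cone p (Defs.conv S).
Proof.
move=> [k Sk]; apply/seteqP; split.
  apply: conv_sub; first by apply: convex_cone; exact: convex_conv.
  move=> z [Sz|->].
    by exists (1, z); [split => /=; [rewrite in_itv/= ler01 lexx|exact: sub_conv]|
      rewrite /= bary1].
  exists (0, k); last by rewrite /= bary0.
  by split => /=; [rewrite in_itv/= lexx ler01|exact: sub_conv].
move=> _ [[s z] /= [s01 Sz] <-]; apply: convex_conv.
- by apply: sub_conv; right.
- by move: z Sz; apply: conv_sub; [exact: convex_conv|move=> z Sz; apply: sub_conv; left].
- by move: s01; rewrite in_itv.
Qed.

Lemma conv_set1 p : Defs.conv [set p] = [set p].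
Proof.
apply/seteqP; split; last exact: sub_conv.
apply: conv_sub => // _ _ t -> -> _ /=.
by case: p => a b; rewrite /bary/=; congr pair; ring.
Qed.

Lemma compact_tri (t : (R * R) * (R * R) * (R * R)) : compact (tri_set t).
Proof.
rewrite /tri_set !conv_setU1 ?conv_set1; last 2 first.
- by exists t.1.1.
- by exists t.1.1; left.
by do 2 apply: compact_cone; exact: compact_set1.
Qed.

Lemma compact_quad (d : on_data R) : compact (quad d).
Proof.
rewrite /quad !conv_setU1 ?conv_set1; last 3 first.
- by exists (p_up d).
- by exists (p_up d); left.
- by exists (p_up d); left; left.
by do 3 apply: compact_cone; exact: compact_set1.
Qed.

Lemma compact_box (B : box R) : compact (box_set B).
Proof. by apply: compact_setX; exact: segment_compact. Qed.

Lemma compact_plane_closed K : compact K -> closed K.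
Proof. by apply: compact_closed; exact: norm_hausdorff. Qed.

Lemma compact_plane_measurable K : compact K -> measurable (K : set (plane R)).
Proof. by move/compact_plane_closed/closed_measurable_plane. Qed.

End Convex.

(** * Boundaries of convex sets are null *)

Section NullSets.
Variable R : realType.
Implicit Types (p q z : R * R) (S : set (R * R)) (V : set R).

Definition aff (a b c : R) z : R := a * z.1 + b * z.2 + c.

Lemma aff_continuous a b c : continuous (aff a b c).
Proof.
move=> z; apply: cvgD; last exact: cvg_cst.
by apply: cvgD; apply: cvgM; (exact: cvg_cst || exact: cvg_fst || exact: cvg_snd).
Qed.

Lemma near_gt0 (T : topologicalType) (f : T -> R) :
  continuous f -> forall x, 0 < f x -> \forall w \near x, 0 < f w.
Proof. by move=> cf x fx; apply: (cvgr_gt (f x)) => //; exact: cf. Qed.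

(** Having at most two points, in the form that follows from the middle one of
    three points being exceptional. *)
Definition thin V := forall a b c, a < b -> b < c -> V a -> V b -> V c -> False.

Lemma thin_countable V : thin V -> countable V.
Proof.
move=> tV.
have [[a [b [ab Va Vb]]]|nV] :=
  pselect (exists a b, [/\ a < b, V a & V b]).
  apply: (@sub_countable _ _ _ [set a; b]); last first.
    by apply: finite_set_countable.
  apply: subset_card_le => c Vc.
  have [ca|ac|<-] := ltgtP c a; last by left.
    by case: (tV c a b).
  have [cb|bc|->] := ltgtP c b; last by right.
    by case: (tV a c b).
  by case: (tV a b c).
have [[a Va]|V0] := pselect (V !=set0); last first.
  by have -> : V = set0; [apply/seteqP; split => // x Vx; case: V0; exists x|].
apply: (@sub_countable _ _ _ [set a]); last exact: finite_set_countable.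
apply: subset_card_le => c Vc; have [ca|ac|//] := ltgtP c a.
- by case: nV; exists c, a.
- by case: nV; exists a, c.
Qed.

(** The triangle spanned by the vertical segment and [(x', y')] contains all
    points near [(x, b)] on the side of [x']. *)
Lemma convex_half_nbhs S x a b c x' y' : convex2 S -> a < b -> b < c ->
  x' != x -> S (x, a) -> S (x, c) -> S (x', y') ->
  \forall w \near ((x, b) : R * R), 0 <= (w.1 - x) / (x' - x) -> S w.
Proof.
move=> cS ab bc xx' Sa Sc S'.
pose k := (x' - x)^-1.
(* [w] lies strictly before [(x', y')], and the line joining them meets the
   given vertical segment in an inner point: three strict affine conditions *)
have : \forall w \near ((x, b) : R * R), 0 < aff (- k) 0 (1 + k * x) w.
  by apply: near_gt0; [exact: aff_continuous|rewrite /aff/=; lra].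
have : \forall w \near ((x, b) : R * R),
    0 < aff (k * (a - y')) 1 (- a - k * x * (a - y')) w.
  by apply: near_gt0; [exact: aff_continuous|rewrite /aff/=; lra].
have : \forall w \near ((x, b) : R * R),
    0 < aff (k * (y' - c)) (- 1) (c - k * x * (y' - c)) w.
  by apply: near_gt0; [exact: aff_continuous|rewrite /aff/=; lra].
apply: filterS3 => -[u v]; rewrite /aff/= => h1 h2 h3 t0.
set t := (u - x) / (x' - x) in t0 *.
have kt : k * (u - x) = t by rewrite /t /k mulrC.
have t1 : 0 < 1 - t by rewrite -kt; lra.
have va : (1 - t) * a + t * y' < v by rewrite -kt; lra.
have vc : v < (1 - t) * c + t * y' by rewrite -kt; lra.
pose w := (v - t * y') / (1 - t).
have vw : v = (1 - t) * w + t * y' by rewrite /w mulrCA divff ?gt_eqF// mulr1 subrK.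
have aw : a < w by rewrite /w ltr_pdivlMr//; lra.
have wc : w < c by rewrite /w ltr_pdivrMr//; lra.
have ac0 : 0 < c - a by lra.
have Sw : S (x, w).
  have := cS _ _ ((w - a) / (c - a)) Sa Sc.
  rewrite /bary/=; have -> : (1 - (w - a) / (c - a)) * x + (w - a) / (c - a) * x = x.
    by ring.
  have -> : (1 - (w - a) / (c - a)) * a + (w - a) / (c - a) * c = w.
    by field; rewrite gt_eqF.
  by apply; rewrite divr_ge0 ?ler_pdivrMr ?mul1r//=; lra.
have := cS _ _ t Sw S'; rewrite /bary/= -vw.
have -> : (1 - t) * x + t * x' = u.
  have -> : u = x + t * (x' - x) by rewrite /t divfK ?subr_eq0//; ring.
  by ring.
by apply; apply/andP; split => //; lra.
Qed.

(** On a vertical line strictly inside the horizontal extent of a convex set,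
    the middle one of three points of the set is interior.  So the boundary
    meets almost every vertical line in at most two points. *)
Lemma convex_boundary_null S : convex2 S ->
  measurable (S : set (plane R)) -> leb2 (S `\` S°) = 0%E.
Proof.
move=> cS mS.
(* [N] consists of the at most two ends of the horizontal extent of [S] *)
pose proj x := exists y, S (x, y).
pose N := [set x | proj x /\ ~ exists x1 x2, [/\ x1 < x, x < x2, proj x1 & proj x2]].
apply: (@leb2_null _ _ N).
- apply: measurableD => //; apply: open_measurable_plane.
  exact: open_interior.
- apply: thin_countable => x1 x x2 x1x xx2 [p1 _] [_ nx] [p2 _].
  by apply: nx; exists x1, x2.
move=> x Nx; apply: thin_countable => a b c ab bc.
move=> /xsectionP[Sa _] /xsectionP[Sb nSb] /xsectionP[Sc _]; apply: nSb.
have [x1 [x2 [x1x xx2 [y1 S1] [y2 S2]]]] :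
    exists x1 x2, [/\ x1 < x, x < x2, proj x1 & proj x2].
  by apply: contrapT => H; apply: Nx; split => //; exists b.
have n1 := convex_half_nbhs cS ab bc (negbT (lt_eqF x1x)) Sa Sc S1.
have n2 := convex_half_nbhs cS ab bc (negbT (gt_eqF xx2)) Sa Sc S2.
apply: filterS2 n1 n2 => w h1 h2.
have [xw|wx] := leP x w.1.
- by apply: h2; rewrite divr_ge0// subr_ge0// ltW.
- by apply: h1; rewrite -mulrNN -invrN divr_ge0// !opprB subr_ge0 ltW.
Qed.

End NullSets.

(** * Zero sets of polynomials are null *)

Section Polynomials.
Variable R : realType.
Implicit Types (p q z : R * R) (S : set (R * R)) (G H : {poly {poly R}}).

Lemma ev_MXaddC G (c : {poly R}) z :
  ev (G * 'X + c%:P) z = ev G z * z.1 + c.[z.2].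
Proof. by rewrite /ev !hornerE. Qed.

Lemma continuous_ev G : continuous (ev G).
Proof.
have c1 : continuous (fst : R * R -> R) by move=> z; exact: cvg_fst.
have c2 : continuous (snd : R * R -> R) by move=> z; exact: cvg_snd.
have ch (c : {poly R}) : continuous (fun z : R * R => c.[z.2]).
  elim/poly_ind: c => [|c a IH] z.
    by rewrite (_ : (fun _ => _) = cst 0);
      [exact: cvg_cst|apply/funext => w; rewrite horner0].
  rewrite (_ : (fun _ => _) = (fun w : R * R => c.[w.2] * w.2 + a)); last first.
    by apply/funext => w; rewrite hornerMXaddC.
  apply: cvgD; last exact: cvg_cst.
  by apply: cvgM; [exact: IH|exact: c2].
elim/poly_ind: G => [|G c IH] z.
  by rewrite (_ : ev 0 = cst 0);
    [exact: cvg_cst|apply/funext => w; rewrite /ev !horner0].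
rewrite (_ : ev _ = (fun w : R * R => ev G w * w.1 + c.[w.2])); last first.
  by apply/funext => w; rewrite ev_MXaddC.
apply: cvgD; last exact: ch.
by apply: cvgM; [exact: IH|exact: c1].
Qed.

Lemma finite_roots (D : idomainType) (T : choiceType) (f : T -> D) (g : {poly D}) :
  injective f -> g != 0 -> finite_set [set x | root g (f x)].
Proof.
move=> f_inj g0; apply: contrapT => /(infinite_set_fset (size g))[B BA].
apply/negP; rewrite -ltnNge.
have := @max_poly_roots _ g (map f (finmap.enum_fset B)) g0.
rewrite size_map; apply.
  by apply/allP => _ /mapP[x xB ->]; apply: (BA x).
by rewrite map_inj_uniq.
Qed.

(** Only finitely many vertical lines carry the zero polynomial, and every
    other one meets the zero set in finitely many points. *)
Lemma zero_set_null G : G != 0 -> leb2 (ev G @^-1` [set 0]) = 0%E.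
Proof.
move=> G0; pose N := [set x : R | root G x%:P].
apply: (@leb2_null _ _ N).
- apply: closed_measurable_plane.
  by apply: closed_comp => [z _|]; [exact: continuous_ev|exact: closed_eq].
- by apply/finite_set_countable/finite_roots => //; exact: polyC_inj.
- move=> x /negP Nx; apply: finite_set_countable.
  rewrite (_ : xsection _ _ = [set y : R | root G.[x%:P] y]).
    exact: (@finite_roots _ _ id).
  by apply/seteqP; split => y; [move=> /xsectionP/eqP|move=> /eqP Hy; exact/xsectionP].
Qed.

End Polynomials.

(** * Integration over tiles *)

Section Integration.
Variable R : realType.
Implicit Types (p q z : R * R) (A D N S : set (plane R)) (B : box R)
  (f : plane R -> R).

Notation mu := (@leb2 R).

Lemma measurable_box B : measurable (box_set B : set (plane R)).
Proof. by apply: measurableX; exact: measurable_itv. Qed.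

Lemma leb2_box B :
  leb2 (box_set B) = ((hi1 B - lo1 B) * (hi2 B - lo2 B))%:E.
Proof.
rewrite /leb2 product_measure1E; [|exact: measurable_itv|exact: measurable_itv].
have len (a b : R) : a <= b -> lebesgue_measure (`[a, b]%classic : set R) = (b - a)%:E.
  rewrite lebesgue_measure_itv/= lte_fin => ab; case: ltP => [_|ba]; first by rewrite EFinB.
  by rewrite (le_anti (introT andP (conj ab ba))) subrr.
by rewrite EFinM; congr (_ * _)%E; apply: len; [exact: box_le1|exact: box_le2].
Qed.

Lemma continuous_measurable_plane (f : R * R -> R) : continuous f ->
  measurable_fun setT (f : plane R -> R).
Proof.
move=> /continuousP cf; apply: (measurability _ (measurable_realfun.RGenOpens.measurableE R)).
move=> _ [_ [a [b ->] <-]]; rewrite setTI; apply: open_measurable_plane.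
exact/cf/interval_open.
Qed.

Lemma continuous_integrable (f : R * R -> R) A B : continuous f ->
  measurable A -> A `<=` box_set B -> mu.-integrable A (EFin \o f).
Proof.
move=> cf mA AB; apply: (integrableS (measurable_box B)) => //.
apply: measurable_bounded_integrable.
- exact: measurable_box.
- by apply: (@le_lt_trans _ _ (leb2 (box_set B))) => //; rewrite leb2_box ltry.
- by apply: measurable_funS (continuous_measurable_plane cf).
- have : compact (f @` box_set B).
    apply: continuous_compact; [exact: continuous_subspaceT|exact: compact_box].
  move=> /compact_bounded[M [Mr HM]]; exists M; split => // x xM z Bz.
  by apply: (HM x xM); exists z.
Qed.

Lemma Rintegral_null A f : measurable A -> measurable_fun A f ->
  leb2 A = 0%E -> \int[mu]_(z in A) f z = 0.
Proof.
move=> mA mf A0; rewrite /Rintegral (@null_set_integral _ _ _ mu A)//.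
exact/measurable_realfun.measurable_EFinP.
Qed.

Lemma Rintegral_setDnull A N f : measurable A -> measurable N ->
  mu.-integrable A (EFin \o f) -> leb2 N = 0%E ->
  \int[mu]_(z in A) f z = \int[mu]_(z in A `\` N) f z.
Proof.
by move=> mA mN fA N0; rewrite /Rintegral (@negligible_integral _ _ _ mu A N).
Qed.

(** Tiles are allowed to share boundary points: these form a null set. *)
Lemma Rintegral_tiles (I : finType) (S : I -> set (R * R)) D f :
  (forall i, measurable (S i : set (plane R))) ->
  (forall i, leb2 (S i `\` (S i)°) = 0%E) ->
  trivIset setT (fun i => (S i)°) ->
  measurable D ->
  mu.-integrable ((\bigcup_i S i) `&` D) (EFin \o f) ->
  \int[mu]_(z in (\bigcup_i S i) `&` D) f z =
  \sum_i \int[mu]_(z in S i `&` D) f z.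
Proof.
move=> mS S0 tS mD fD.
have fI (T : set (plane R)) : measurable T -> T `<=` (\bigcup_i S i) `&` D ->
    mu.-integrable T (EFin \o f).
  move=> mT TS; apply: integrableS fD => //; apply: measurableI => //.
  by apply: fin_bigcup_measurable => //; exact: finite_finset.
have mU : measurable ((\bigcup_i S i) `&` D : set (plane R)).
  apply: measurableI => //.
  by apply: fin_bigcup_measurable => //; exact: finite_finset.
have mint i : measurable ((S i)° : set (plane R)).
  by apply: open_measurable_plane; exact: open_interior.
pose N : set (plane R) := \bigcup_i (S i `\` (S i)°).
have mN : measurable N.
  apply: fin_bigcup_measurable; first exact: finite_finset.
  by move=> i _; apply: measurableD.
have N0 : leb2 N = 0%E.
  have : (mu : measure _ _).-negligible N.
    rewrite /N -[setT](_ : [set` index_enum I] = _); last first.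
      by apply/seteqP; split => // i _; rewrite /= mem_index_enum.
    rewrite bigcup_seq; elim/big_ind : _ => [|A1 A2|i _].
    - exact: negligible_set0.
    - exact: negligibleU.
    - by apply/negligibleP; [exact: measurableD|exact: S0].
  by move=> /measure_negligible; exact.
pose T i : set (plane R) := (S i `&` D) `\` N.
have mT i : measurable (T i) by apply: measurableD => //; exact: measurableI.
have eT : ((\bigcup_i S i) `&` D) `\` N = \big[setU/set0]_(i <- index_enum I) T i.
  rewrite -bigcup_seq; apply/seteqP; split => [z [[[i _ Si] Dz] Nz]|z [i _ [[Si Dz] Nz]]].
    by exists i; [rewrite /= mem_index_enum|].
  by split => //; split => //; exists i.
rewrite (Rintegral_setDnull mU mN fD N0) eT /Rintegral integral_bigsetU_EFin//.
- have key i : (\int[mu]_(x in T i) (f x)%:E =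
      (\int[mu]_(x in T i) f x)%R%:E)%E.
    rewrite fineK//; apply: integrable_fin_num => //.
    by apply: fI => // z [[Si Dz] _]; split => //; exists i.
  rewrite (eq_bigr _ (fun i _ => key i)).
  rewrite sumEFin/=.
  apply: eq_bigr => i _; rewrite -[RHS]/(Rintegral mu _ _).
  rewrite (@Rintegral_setDnull (S i `&` D) N)//; first exact: measurableI.
  by apply: fI => [|z [Si Dz]]; [exact: measurableI|split => //; exists i].
- exact: index_enum_uniq.
- move=> i j _ _ [z [[[Si _] Nz] [[Sj _] _]]]; apply: tS => //.
  by exists z; split; apply: contrapT => nS; apply: Nz; [exists i|exists j].
- rewrite -eT; apply: (measurable_int mu); apply: fI; first exact: measurableD.
  by move=> z [].
Qed.

End Integration.

(** * Exact integrals over boxes *)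

Section BoxIntegrals.
Variable R : realType.
Implicit Types (p q z : R * R) (B : box R) (f g : R -> R).

Notation mu := (@leb2 R).
Notation leb := (@lebesgue_measure R).

Lemma continuous_itv_integrable f (a b : R) : continuous f ->
  leb.-integrable `[a, b] (EFin \o f).
Proof.
move=> cf; apply: continuous_compact_integrable; first exact: segment_compact.
exact: continuous_subspaceT.
Qed.

Lemma continuous_prod f g : continuous f -> continuous g ->
  continuous (fun z : R * R => f z.1 * g z.2).
Proof.
move=> cf cg z; apply: cvgM.
- by apply: (@continuous_comp _ _ _ fst f); [exact: cvg_fst|exact: cf].
- by apply: (@continuous_comp _ _ _ snd g); [exact: cvg_snd|exact: cg].
Qed.

Lemma Rintegral_box f g B : continuous f -> continuous g ->
  \int[mu]_(z in box_set B) (f z.1 * g z.2) =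
  (\int[leb]_(x in `[lo1 B, hi1 B]) f x) * \int[leb]_(y in `[lo2 B, hi2 B]) g y.
Proof.
move=> cf cg; set h := fun z : plane R => f z.1 * g z.2.
have ih : mu.-integrable (box_set B) (EFin \o h).
  apply: (@continuous_integrable _ _ _ B) => //; last exact: measurable_box.
  exact: continuous_prod.
have fg (k : R -> R) a b : continuous k ->
    (\int[leb]_(x in `[a, b]) (k x)%:E)%E = (\int[leb]_(x in `[a, b]) k x)%R%:E.
  by move=> ck; rewrite fineK//; apply: integrable_fin_num => //; exact: continuous_itv_integrable.
rewrite {1}/Rintegral integral_mkcond.
rewrite -[X in fine X]integral12_prod_meas1; last first.
  by apply/(integrable_mkcond _ (measurable_box B)).
rewrite -[RHS]/(fine (_)%:E) EFinM -fg//; congr fine.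
rewrite -integralZr//; try exact: continuous_itv_integrable.
rewrite [RHS]integral_mkcond; apply: eq_integral => x _.
rewrite /fubini_F patchE; case: ifPn => xI.
  rewrite -fg//.
  rewrite -integralZl//; try exact: continuous_itv_integrable.
  rewrite [RHS]integral_mkcond; apply: eq_integral => y _.
  rewrite !patchE; have -> : ((x, y) \in box_set B) = (y \in (`[lo2 B, hi2 B]%classic : set R)).
    apply/idP/idP; rewrite !inE; first by case.
    by move=> yI; split => //=; exact: set_mem xI.
  by [].
transitivity (0%E : \bar R) => //.
apply: integral0_eq => y _; rewrite patchE ifN//.
by apply: contra xI; rewrite !inE => -[].
Qed.

Lemma Rintegral_expr k (a b : R) : a <= b ->
  \int[leb]_(x in `[a, b]) (x ^+ k) = b ^+ k.+1 / k.+1%:R - a ^+ k.+1 / k.+1%:R.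
Proof.
rewrite le_eqVlt => /predU1P[->|ab].
  by rewrite set_itv1 Rintegral_set1 subrr.
pose F (x : R) := k.+1%:R^-1 * x ^+ k.+1.
have cF : continuous F.
  by move=> x; apply: cvgM; [exact: cvg_cst|exact: exprn_continuous].
rewrite /Rintegral (@continuous_FTC2 _ _ F)//.
- by rewrite /F !(mulrC _^-1).
- by apply: continuous_subspaceT => x; exact: exprn_continuous.
- split => [x _||].
  + by apply: derivableM => //; exact: exprn_derivable.
  + by apply: cvg_at_right_filter; exact: cF.
  + by apply: cvg_at_left_filter; exact: cF.
- move=> x _; rewrite derive1Ml; last exact: exprn_derivable.
  by rewrite exp_derive1/= -[_ *: _]/(_ * _) mulKf// pnatr_eq0.
Qed.

End BoxIntegrals.

(** * Enclosures of integrals of monomials *)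

Section Enclosures.
Variable R : realType.
Implicit Types (p q z : R * R) (B : box R) (K : set (R * R)) (X Y : set R)
  (S : set (plane R)) (f : R * R -> R).

Notation mu := (@leb2 R).
Notation leb := (@lebesgue_measure R).

Lemma continuous_monomial i j : continuous (@monomial R i j).
Proof.
exact: (continuous_prod (@exprn_continuous _ i) (@exprn_continuous _ j)).
Qed.

Lemma Rintegral_monomial i j B :
  \int[mu]_(z in box_set B) monomial i j z = J i j B.
Proof.
rewrite (Rintegral_box B (@exprn_continuous _ i) (@exprn_continuous _ j)).
by rewrite !Rintegral_expr ?box_le1 ?box_le2.
Qed.

Lemma hull0_sub X x : X x -> hull0 X x.
Proof. by move=> Xx; apply: sub_gen_smallest; right. Qed.

Lemma hull0_0 X : hull0 X 0.
Proof. by apply: sub_gen_smallest; left. Qed.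

Lemma hull0_itv X x y v : hull0 X x -> hull0 X y -> x <= v <= y -> hull0 X v.
Proof. by move=> Xx Xy xvy A [iA XA]; apply: (iA x y) => //; [exact: Xx|exact: Xy]. Qed.

Definition abs_moment k (a b : R) := \int[leb]_(x in `[a, b]) `|x ^+ k|.

Lemma continuous_normX k : continuous (fun x : R => `|x ^+ k|).
Proof.
by move=> x; apply: cvg_norm; exact: exprn_continuous.
Qed.

(** [Jt_factor] is the exact integral when the power keeps its sign, and the
    symmetric interval of radius the integral of the absolute value when it
    changes sign at [0]. *)
Lemma Jt_factorP k (a b : R) : a <= b ->
  (exists s : R, [/\ `|s| = 1, forall x, a <= x <= b -> x ^+ k = s * `|x ^+ k|
     & Jt_factor k a b = [set s * abs_moment k a b]]) \/
  Jt_factor k a b = `[- abs_moment k a b, abs_moment k a b]%classic.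
Proof.
move=> ab.
have Eint (s : R) (c d : R) : c <= d ->
    (forall x, c <= x <= d -> x ^+ k = s * `|x ^+ k|) ->
    s * abs_moment k c d = d ^+ k.+1 / k.+1%:R - c ^+ k.+1 / k.+1%:R.
  move=> cd hs; rewrite -Rintegral_expr// -RintegralZl//.
  - by apply: eq_Rintegral => x; rewrite inE/= in_itv/= => /hs.
  - by apply: continuous_itv_integrable; exact: continuous_normX.
have pos (x : R) : 0 <= x -> x ^+ k = 1 * `|x ^+ k|.
  by move=> x0; rewrite mul1r ger0_norm// exprn_ge0.
have neg (x : R) : odd k -> x <= 0 -> x ^+ k = -1 * `|x ^+ k|.
  move=> ok x0; rewrite mulN1r ler0_norm ?opprK//.
  by rewrite -[x]opprK exprNn -signr_odd ok expr1 mulN1r oppr_le0 exprn_ge0// oppr_ge0.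
rewrite /Jt_factor; case: ifPn => [/andP[/andP[a0 b0] ok]|h].
  right; suff -> : abs_moment k a b = b ^+ k.+1 / k.+1%:R + a ^+ k.+1 / k.+1%:R by [].
  have iN : leb.-integrable `[a, b] (EFin \o (fun x : R => `|x ^+ k|)).
    by apply: continuous_itv_integrable; exact: continuous_normX.
  have := @Rintegral_itvB _ (fun x : R => `|x ^+ k|) (BLeft a) (BRight b) 0 iN.
  rewrite !bnd_simp => /(_ a0 b0).
  rewrite Rintegral_itv_obnd_cbnd; last first.
    by apply: integrableS iN => //; apply: subset_itvr; rewrite bnd_simp.
  rewrite -!/(abs_moment _ _ _).
  have := Eint 1 0 b b0 (fun x xb => pos x (andP xb).1).
  have := Eint (-1) a 0 a0 (fun x xb => neg x ok (andP xb).2).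
  rewrite expr0n/= mul0r.
  move: (a ^+ k.+1 / _) (b ^+ k.+1 / _) => u w; lra.
left; have [s [s1 hs]] : exists s : R, `|s| = 1 /\
    forall x, a <= x <= b -> x ^+ k = s * `|x ^+ k|.
  have [ok|ek] := boolP (odd k); last first.
    exists 1; split; first exact: normr1.
    move=> x _; rewrite mul1r ger0_norm//; apply: exprn_even_ge0.
    by rewrite ek.
  move: h; rewrite ok andbT negb_and -!ltNge => /orP[a0|b0].
    exists 1; split; first exact: normr1.
    by move=> x /andP[ax _]; apply: pos; lra.
  exists (-1); split; first by rewrite normrN normr1.
  by move=> x /andP[_ xb]; apply: neg => //; lra.
by exists s; split => //; rewrite (Eint s).
Qed.

Lemma imul_sym_itv (F G v y : R) : 0 <= F -> `|y| = G -> `|v| <= F * G ->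
  exists2 x, `[- F, F]%classic x & v = x * y.
Proof.
move=> F0 yG; have [y0|y0] := eqVneq y 0.
  rewrite -yG y0 normr0 mulr0 normr_le0 => /eqP ->.
  by exists 0; rewrite ?mulr0//= in_itv/= oppr_le0 F0.
move=> vFG; exists (v / y); last by rewrite divfK.
by rewrite /= in_itv/= -ler_norml normf_div yG ler_pdivrMr// -yG normr_gt0.
Qed.

Lemma Rintegral_le_box (g : R * R -> R) S B : continuous g -> (forall z, 0 <= g z) ->
  measurable S -> S `<=` box_set B ->
  \int[mu]_(z in S) g z <= \int[mu]_(z in box_set B) g z.
Proof.
move=> cg g0 mS SB; have mB := measurable_box B.
have iB : mu.-integrable (box_set B) (EFin \o g).
  by apply: (@continuous_integrable _ _ _ B).
rewrite /Rintegral fine_le//.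
- exact/integrable_fin_num/(integrableS mB mS SB).
- exact: integrable_fin_num.
- apply: ge0_subset_integral => //; last by move=> z _; rewrite lee_fin.
  exact: (measurable_int mu).
Qed.

(** When the monomial keeps its sign on the box, the integral over a part lies
    between [0] and the integral over the box.  Otherwise it is bounded by the
    integral of the absolute value, which is the product of the two
    one-dimensional ones, and [Jt] is symmetric. *)
Lemma hull0_Jt_Rintegral i j S B : measurable S -> S `<=` box_set B ->
  hull0 (Jt i j B) (\int[mu]_(z in S) monomial i j z).
Proof.
move=> mS SB.
set F := abs_moment i (lo1 B) (hi1 B); set G := abs_moment j (lo2 B) (hi2 B).
pose m z := `|monomial i j z|.
have cm : continuous m by move=> z; apply: cvg_norm; exact: continuous_monomial.
have F0 : 0 <= F by apply: Rintegral_ge0.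
have G0 : 0 <= G by apply: Rintegral_ge0.
have mB : \int[mu]_(z in box_set B) m z = F * G.
  rewrite -(Rintegral_box B (@continuous_normX i) (@continuous_normX j)).
  by apply: eq_Rintegral => z _; rewrite /m /monomial normrM.
set u := \int[mu]_(z in S) m z.
have uFG : u <= F * G.
  by rewrite -mB; apply: Rintegral_le_box => // z; exact: normr_ge0.
have u0 : 0 <= u by apply: Rintegral_ge0 => z _; exact: normr_ge0.
have iS (g : R * R -> R) : continuous g -> mu.-integrable S (EFin \o g).
  by move=> cg; apply: (@continuous_integrable _ _ _ B).
set v := \int[mu]_(z in S) monomial i j z.
have vFG : `|v| <= F * G.
  apply: le_trans uFG; apply: le_normr_Rintegral => //.
  by apply: iS; exact: continuous_monomial.
rewrite /Jt.
have [[s [s1 hs ->]]|->] := Jt_factorP i (box_le1 B);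
    have [[t [t1 ht ->]]|->] := Jt_factorP j (box_le2 B).
- have -> : v = s * t * u.
    rewrite /u -RintegralZl//; last exact: iS.
    apply: eq_Rintegral => z; rewrite inE => /SB[]; rewrite /= !in_itv/= => z1 z2.
    by rewrite /m /monomial normrM (hs z.1)// (ht z.2)// !normrM !normr_id s1 t1; ring.
  have st1 : `|s * t| = 1 by rewrite normrM s1 t1 mulr1.
  have st : hull0 (imul [set s * F] [set t * G]) (s * t * (F * G)).
    by apply: hull0_sub; exists (s * F) => //; exists (t * G) => //; ring.
  have [st0|st0] := leP 0 (s * t).
  + move: st st1; rewrite ger0_norm// => + st1; rewrite st1 !mul1r => st.
    by apply: (hull0_itv (@hull0_0 _) st); rewrite u0.
  + move: st st1; rewrite ltr0_norm// => + st1.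
    have -> : s * t = -1 by lra.
    move=> st; apply: (hull0_itv st (@hull0_0 _)); rewrite !mulN1r lerN2 uFG/=.
    by rewrite oppr_le0.
- apply: hull0_sub; rewrite mulrC in vFG.
  have sF : `|s * F| = F by rewrite normrM s1 mul1r ger0_norm.
  have [y Gy ->] := imul_sym_itv G0 sF vFG.
  by exists (s * F) => //; exists y => //; rewrite mulrC.
- apply: hull0_sub.
  have tG : `|t * G| = G by rewrite normrM t1 mul1r ger0_norm.
  have [x Fx ->] := imul_sym_itv F0 tG vFG.
  by exists x => //; exists (t * G).
- apply: hull0_sub.
  have GG : `|G| = G by rewrite ger0_norm.
  have [x Fx ->] := imul_sym_itv F0 GG vFG.
  by exists x => //; exists G => //; rewrite /= in_itv/= lexx andbT ge0_cp.
Qed.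

Lemma bbox_term_mem i j K z : K z ->
  bbox_term i j K (monomial i j z * area K).
Proof.
move=> Kz; have bz : bbox K z by apply: sub_gen_smallest.
exists (monomial i j z); last by exists (area K).
exists (z.1 ^+ i); first by exists z.1 => //; exists z.
by exists (z.2 ^+ j) => //; exists z.2 => //; exists z.
Qed.

Lemma leb2_lty S B : measurable S -> S `<=` box_set B -> (leb2 S < +oo)%E.
Proof.
move=> mS SB; apply: (@le_lt_trans _ _ (leb2 (box_set B))).
  by apply: le_measure => //; apply: mem_set => //; exact: measurable_box.
by rewrite leb2_box ltry.
Qed.

Lemma Rintegral_area_bounds f S B (a b : R) : continuous f ->
  measurable S -> S `<=` box_set B -> (forall z, S z -> a <= f z <= b) ->
  a * area S <= \int[mu]_(z in S) f z <= b * area S.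
Proof.
move=> cf mS SB fab.
have iS (g : R * R -> R) : continuous g -> mu.-integrable S (EFin \o g).
  by move=> cg; apply: (@continuous_integrable _ _ _ B).
have ic (c : R) : mu.-integrable S (EFin \o cst c) by apply: iS; exact: cst_continuous.
rewrite /area -!(@Rintegral_cst _ _ _ mu)//; apply/andP; split.
- by apply: (le_Rintegral mS (ic _) (iS _ cf)) => z /fab/andP[].
- by apply: (le_Rintegral mS (iS _ cf) (ic _)) => z /fab/andP[].
Qed.

Lemma compact_extrema f K : continuous f -> compact K -> K !=set0 ->
  exists p q, [/\ K p, K q & forall z, K z -> f p <= f z <= f q].
Proof.
move=> cf cK K0.
have cfK : {within K, continuous f} by exact: continuous_subspaceT.
have [p Kp hp] := compact_EVT_min K0 cK cfK.
have [q Kq hq] := compact_EVT_max K0 cK cfK.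
exists p, q; rewrite !inE in Kp Kq; split => // z Kz.
by rewrite hp ?hq ?inE.
Qed.

Lemma continuous_along_segment f p q : continuous f ->
  continuous (fun t : R => f (bary t p q)).
Proof.
move=> cf t; apply: (@continuous_comp _ _ _ (fun t => bary t p q) f); last exact: cf.
have lin (a b : R) : continuous (fun t : R => (1 - t) * a + t * b).
  move=> x; apply: cvgD; apply: cvgM; try exact: cvg_cst; last exact: cvg_id.
  by apply: cvgB; [exact: cvg_cst|exact: cvg_id].
by apply: continuous_plane; exact: lin.
Qed.

Lemma segment_IVT f p q v : continuous f ->
  Num.min (f p) (f q) <= v <= Num.max (f p) (f q) ->
  exists2 t, 0 <= t <= 1 & f (bary t p q) = v.
Proof.
move=> cf pvq; pose g t := f (bary t p q).
have [||t t01 gt] := @IVT _ g 0 1 v ler01.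
- by apply: continuous_subspaceT; exact: continuous_along_segment.
- by rewrite /g bary0 bary1.
- by exists t.
Qed.

(** Mean value theorem on a compact convex set. *)
Lemma bbox_term_Rintegral i j K B : convex2 K -> compact K -> K !=set0 ->
  K `<=` box_set B ->
  bbox_term i j K (\int[mu]_(z in K) monomial i j z).
Proof.
move=> cvK cK K0 KB; have mK := compact_plane_measurable cK.
have cm := @continuous_monomial i j.
have [p [q [Kp Kq pq]]] := compact_extrema cm cK K0.
set v := Rintegral _ _ _.
have /andP[pv vq] : monomial i j p * area K <= v <= monomial i j q * area K.
  exact: (Rintegral_area_bounds cm mK KB pq).
have : 0 <= area K by rewrite /area fine_ge0.
rewrite le_eqVlt => /predU1P[K0'|Kpos].
  have -> : v = monomial i j p * area K.
    by move: pv vq; rewrite -K0' !mulr0 => ? ?; apply/le_anti/andP.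
  exact: bbox_term_mem.
have [|t t01 tv] := @segment_IVT (monomial i j) p q (v / area K) cm.
  rewrite ge_min le_max !ler_pdivlMr// !ler_pdivrMr//.
  by rewrite pv vq orbT.
have -> : v = monomial i j (bary t p q) * area K by rewrite tv divfK// gt_eqF.
by apply: bbox_term_mem; exact: cvK.
Qed.

(** The mean of the monomial over [S] lies between its extrema on [K], and the
    area of [S] between [0] and that of [K]. The hull with [0] absorbs the
    second uncertainty. *)
Lemma hull0_bbox_term_Rintegral i j K S B : compact K -> K !=set0 ->
  K `<=` box_set B -> measurable S -> S `<=` K ->
  hull0 (bbox_term i j K) (\int[mu]_(z in S) monomial i j z).
Proof.
move=> cK K0 KB mS SK; have mK := compact_plane_measurable cK.
have cm := @continuous_monomial i j.
have [p [q [Kp Kq pq]]] := compact_extrema cm cK K0.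
set v := Rintegral _ _ _.
have /andP[pv vq] : monomial i j p * area S <= v <= monomial i j q * area S.
  apply: (Rintegral_area_bounds cm mS (subset_trans SK KB)) => z Sz.
  exact/pq/SK.
have S0 : 0 <= area S by rewrite /area fine_ge0.
have SKa : area S <= area K.
  rewrite /area fine_le// ?ge0_fin_numE//.
  - exact: leb2_lty mS (subset_trans SK KB).
  - exact: leb2_lty mK KB.
  - by apply: le_measure => //; exact: mem_set.
have := hull0_sub (bbox_term_mem i j Kp); have := hull0_sub (bbox_term_mem i j Kq).
move: (monomial i j p) (monomial i j q) pv vq => mp mq pv vq hq hp.
have [v0|v0] := leP 0 v.
  have [q0|q0] := leP 0 mq.
    apply: (hull0_itv (@hull0_0 _) hq); rewrite v0/=.
    exact/(le_trans vq)/ler_wpM2l.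
  have -> : v = 0.
    by apply/le_anti/andP; split => //; apply: (le_trans vq); rewrite nmulr_rle0.
  exact: hull0_0.
have [p0|p0] := leP mp 0.
  apply: (hull0_itv hp (@hull0_0 _)); rewrite (ltW v0) andbT.
  by apply: le_trans pv; exact: ler_wnM2l.
by have := le_trans (mulr_ge0 (ltW p0) S0) pv; rewrite leNgt v0.
Qed.

End Enclosures.

(** * The hull of four points on two sides of a strip or of a quadrant *)

Section Quadrilateral.
Variable R : realType.
Implicit Types (p q z w u : R * R) (K C : set (R * R)) (a b f g : R * R -> R).

Definition affine f := exists c1 c2 c0, f = aff c1 c2 c0.

Lemma affine_bary f t p q : affine f ->
  f (bary t p q) = (1 - t) * f p + t * f q.
Proof. by move=> [c1 [c2 [c0 ->]]]; rewrite /aff /bary/=; ring. Qed.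

Lemma affine_continuous f : affine f -> continuous f.
Proof. by move=> [c1 [c2 [c0 ->]]]; exact: aff_continuous. Qed.

Lemma affine_comb f g c1 c2 c0 : affine f -> affine g ->
  affine (fun w => c1 * f w + c2 * g w + c0).
Proof.
move=> [f1 [f2 [f0 ->]]] [g1 [g2 [g0 ->]]].
exists (c1 * f1 + c2 * g1), (c1 * f2 + c2 * g2), (c1 * f0 + c2 * g0 + c0).
by apply/funext => w; rewrite /aff; ring.
Qed.

Lemma convex_half_plane f : affine f -> convex2 [set w | 0 <= f w].
Proof.
move=> af p q t /= fp fq /andP[t0 t1]; rewrite affine_bary//.
by rewrite addr_ge0// mulr_ge0// subr_ge0.
Qed.

(** The convex hull of four points, in a form that makes exchanging the roles of
    the points immediate. *)
Definition hull4 K p p' q q' := [/\ convex2 K, [/\ K p, K p', K q & K q'] &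
  forall C, convex2 C -> C p -> C p' -> C q -> C q' -> K `<=` C].

Lemma hull4_swap K p p' q q' : hull4 K p p' q q' -> hull4 K p' p q' q.
Proof.
by move=> [cK [? ? ? ?] mK]; split=> // C cC ? ? ? ?; exact: mK.
Qed.

Lemma hull4_half_plane K p p' q q' f : hull4 K p p' q q' -> affine f ->
  0 <= f p -> 0 <= f p' -> 0 <= f q -> 0 <= f q' ->
  forall w, K w -> 0 <= f w.
Proof. by move=> [_ _ mK] af fp fp' fq fq'; apply: mK => //; exact: convex_half_plane. Qed.

Lemma hull4_segment K p p' q q' t w w' : hull4 K p p' q q' -> K w -> K w' ->
  0 <= t <= 1 -> K (bary t w w').
Proof. by move=> [cK _ _] Kw Kw'; exact: cK. Qed.

(** Affine coordinates adapted to the box: this treats all positions of the two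
    sides at once. *)
Variables (a b : R * R -> R).
Hypotheses (aa : affine a) (ab : affine b).
Hypothesis coord_inj : forall w w', a w = a w' -> b w = b w' -> w = w'.

Section Opposite.
Variables (p p' q q' : R * R) (l : R).
Hypotheses (l_gt0 : 0 < l) (ap : a p = 0) (ap' : a p' = 0)
  (aq : a q = l) (aq' : a q' = l).

(** For [p] on the line [a = 0] and [q] on the line [a = l], this is [l] times
    the height of the chord [p q] above [w], measured by [b]. *)
Definition strip_slack p q w := (l - a w) * b p + a w * b q - l * b w.

Lemma strip_slack_affine x y : affine (strip_slack x y).
Proof.
have -> : strip_slack x y = fun w => (b y - b x) * a w + (- l) * b w + l * b x.
  by apply/funext => w; rewrite /strip_slack; ring.
exact: affine_comb.
Qed.

Lemma strip_slack_eq0 w x y : a x = 0 -> a y = l -> 0 <= a w <= l -> strip_slack x y w = 0 ->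
  segment x y w.
Proof.
move=> ax ay /andP[w0 wl] s0; exists (a w / l).
  by rewrite /= in_itv/= divr_ge0 ?(ltW l_gt0)//= ler_pdivrMr// mul1r.
rewrite -/(bary _ x y); apply: coord_inj; rewrite affine_bary//.
  by rewrite ax ay mulr0 add0r divfK// gt_eqF.
apply: (mulfI (lt0r_neq0 l_gt0)).
have -> : l * ((1 - a w / l) * b x + a w / l * b y) = (l - a w) * b x + a w * b y.
  by field; rewrite gt_eqF.
by move: s0; rewrite /strip_slack; lra.
Qed.

(** In the strip [0 <= a <= l] the hull is the region between two graphs over
    [a]. *)
Lemma hull4_nbhs_opposite K z : hull4 K p p' q q' -> b p' < b p -> b q' < b q ->
  K z -> ~ segment p q z -> ~ segment p' q' z ->
  \forall w \near z, 0 <= a w <= l -> K w.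
Proof.
move=> hK pp qq Kz nz nz'; have l0 := l_gt0.
have strip w : K w -> 0 <= a w <= l.
  move=> Kw; have ha : affine (fun w => (-1) * a w + 0 * a w + l) by exact: affine_comb.
  have h1 : 0 <= a w.
    by apply: (hull4_half_plane hK aa) Kw; rewrite ?ap ?ap' ?aq ?aq'//; lra.
  have h2 : 0 <= (-1) * a w + 0 * a w + l.
    by apply: (hull4_half_plane hK ha) Kw; rewrite ?ap ?ap' ?aq ?aq'; lra.
  by rewrite h1/=; lra.
have lp : 0 < l * (b p - b p') by rewrite mulr_gt0// subr_gt0.
have lq : 0 < l * (b q - b q') by rewrite mulr_gt0// subr_gt0.
have up w : K w -> 0 <= strip_slack p q w.
  by apply: (hull4_half_plane hK (strip_slack_affine p q)); rewrite /strip_slack ?ap ?ap' ?aq ?aq'; lra.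
have dn w : K w -> strip_slack p' q' w <= 0.
  have -> : (strip_slack p' q' w <= 0) = (0 <= -1 * strip_slack p' q' w + 0 * a w + 0) by lra.
  apply: (hull4_half_plane hK (affine_comb (-1) 0 0 (strip_slack_affine p' q') aa));
    rewrite /strip_slack ?ap ?ap' ?aq ?aq'; lra.
have upz : 0 < strip_slack p q z.
  by rewrite lt_neqAle up// andbT; apply/eqP => /esym/strip_slack_eq0 H; apply/nz/H => //; exact: strip.
have dnz : 0 < - strip_slack p' q' z.
  by rewrite oppr_gt0 lt_neqAle dn// andbT; apply/eqP => /strip_slack_eq0 H; apply/nz'/H => //; exact: strip.
have nup : \forall w \near z, 0 < strip_slack p q w.
  by apply: near_gt0 => //; exact/affine_continuous/strip_slack_affine.
have ndn : \forall w \near z, 0 < - strip_slack p' q' w.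
  by apply: near_gt0 => // x; apply: cvgN; exact/affine_continuous/strip_slack_affine.
apply: filterS2 nup ndn => w upw dnw /andP[w0 wl].
have [_ [Kp Kp' Kq Kq'] _] := hK.
have t01 : 0 <= a w / l <= 1.
  by rewrite divr_ge0 ?(ltW l_gt0)//= ler_pdivrMr// mul1r.
pose u := bary (a w / l) p q; pose u' := bary (a w / l) p' q'.
have lu x y : l * b (bary (a w / l) x y) = (l - a w) * b x + a w * b y.
  by rewrite affine_bary//; field; rewrite gt_eqF.
have ua x y : a x = 0 -> a y = l -> a (bary (a w / l) x y) = a w.
  by move=> ax ay; rewrite affine_bary// ax ay mulr0 add0r divfK// gt_eqF.
have wu : b w < b u by rewrite -(ltr_pM2l l_gt0) lu; move: upw; rewrite /strip_slack; lra.
have u'w : b u' < b w by rewrite -(ltr_pM2l l_gt0) lu; move: dnw; rewrite /strip_slack; lra.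
have uu' : 0 < b u - b u' by lra.
pose t := (b w - b u') / (b u - b u').
have -> : w = bary t u' u.
  apply: coord_inj; rewrite affine_bary// ?ua//; first by ring.
  by rewrite /t; field; rewrite gt_eqF.
apply: (hull4_segment hK); try exact: (hull4_segment hK).
by rewrite /t divr_ge0 ?ler_pdivrMr ?mul1r//=; lra.
Qed.

Lemma opposite_cross : b p' < b p -> b q <= b q' ->
  segment p q `&` segment p' q' !=set0.
Proof.
(* the difference of the heights of the chords changes sign, and [t] is the
   root of this affine function *)
move=> pp qq; pose t := (b p - b p') / ((b p - b p') + (b q' - b q)).
have D0 : 0 < (b p - b p') + (b q' - b q) by lra.
have t01 : 0 <= t <= 1 by rewrite /t divr_ge0 ?ler_pdivrMr ?mul1r//=; lra.
exists (bary t p q); split; exists t; rewrite /= ?in_itv//=.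
rewrite -/(bary _ p' q'); apply: coord_inj; rewrite !affine_bary// ?ap ?ap' ?aq ?aq'//.
by rewrite /t; field; rewrite gt_eqF.
Qed.

End Opposite.

Section Adjacent.
Variables (p p' q q' : R * R).
Hypotheses (ap : a p = 0) (ap' : a p' = 0) (bq : b q = 0) (bq' : b q' = 0).

(** For [p] on the line [a = 0] and [q] on the line [b = 0], this affine function
    vanishes on the chord [p q] and is at most [0] at the corner when [b p] and
    [a q] are nonnegative. *)
Definition corner_slack p q w := a q * b w + b p * a w - a q * b p.

Lemma corner_slack_affine x y : affine (corner_slack x y).
Proof.
have -> : corner_slack x y = fun w => b x * a w + a y * b w + (- (a y * b x)).
  by apply/funext => w; rewrite /corner_slack; ring.
exact: affine_comb.
Qed.

Lemma corner_slack_eq0 w x y : a x = 0 -> b y = 0 -> 0 < b x -> 0 < a y ->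
  0 <= a w -> 0 <= b w -> corner_slack x y w = 0 -> segment x y w.
Proof.
move=> ax by0 bx ay aw bw s0; exists (a w / a y).
  rewrite /= in_itv/= divr_ge0 ?(ltW ay)//= ler_pdivrMr// mul1r.
  by move: s0; rewrite /corner_slack => s0; rewrite -(ler_pM2l bx); nra.
rewrite -/(bary _ x y); apply: coord_inj; rewrite affine_bary//.
  by rewrite ax mulr0 add0r divfK// gt_eqF.
rewrite by0 mulr0 addr0; apply: (mulfI (lt0r_neq0 ay)).
have -> : a y * ((1 - a w / a y) * b x) = a y * b x - b x * a w.
  by field; rewrite gt_eqF.
by move: s0; rewrite /corner_slack; lra.
Qed.

(** [u'] and [u] lie on the ray from the corner through [w], the former not
    beyond [w] and the latter not before it. *)
Lemma ray_mem K x y u u' w : convex2 K -> K u -> K u' -> y <= 1 -> 1 <= x ->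
  a u = x * a w -> b u = x * b w -> a u' = y * a w -> b u' = y * b w -> K w.
Proof.
move=> cK Ku Ku' y1 x1 au bu au' bu'.
have [xy|xy] := eqVneq x y.
  have x11 : x = 1 by apply/le_anti/andP; split => //; rewrite xy.
  suff -> : w = u by [].
  by apply: coord_inj; rewrite ?au ?bu x11 mul1r.
have D0 : 0 < x - y by rewrite subr_gt0 lt_neqAle eq_sym xy; lra.
pose t := (1 - y) / (x - y).
have -> : w = bary t u' u.
  by apply: coord_inj; rewrite affine_bary// ?au ?bu ?au' ?bu' /t; field; rewrite gt_eqF.
by apply: cK => //; rewrite /t divr_ge0 ?ler_pdivrMr ?mul1r//=; lra.
Qed.

(** In the quadrant [0 <= a], [0 <= b] the hull consists of the points that lie
    beyond the inner segment and before the outer one on their ray from the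
    corner.  The inner segment may touch the corner, in which case it lies on
    the boundary of the quadrant and bounds nothing. *)
Lemma hull4_nbhs_adjacent K z : hull4 K p p' q q' ->
  0 <= b p' -> b p' < b p -> 0 <= a q' -> a q' < a q ->
  K z -> ~ segment p q z -> ~ segment p' q' z ->
  \forall w \near z, 0 <= a w -> 0 <= b w -> K w.
Proof.
move=> hK bp'0 pp aq'0 qq Kz nz nz'.
have bp0 : 0 < b p by lra.
have aq0 : 0 < a q by lra.
have pos w : K w -> 0 <= a w /\ 0 <= b w.
  move=> Kw; split.
    by apply: (hull4_half_plane hK aa) Kw; rewrite ?ap ?ap'//; lra.
  by apply: (hull4_half_plane hK ab) Kw; rewrite ?bq ?bq'//; lra.
have dn w : K w -> 0 <= corner_slack p' q' w.
  apply: (hull4_half_plane hK (corner_slack_affine p' q')); rewrite /corner_slack ?ap ?ap' ?bq ?bq'; nra.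
have up w : K w -> corner_slack p q w <= 0.
  have -> : (corner_slack p q w <= 0) = (0 <= -1 * corner_slack p q w + 0 * a w + 0) by lra.
  apply: (hull4_half_plane hK (affine_comb (-1) 0 0 (corner_slack_affine p q) aa));
    rewrite /corner_slack ?ap ?ap' ?bq ?bq'; nra.
have [az bz] := pos z Kz.
have upz : 0 < - corner_slack p q z.
  by rewrite oppr_gt0 lt_neqAle up// andbT; apply/eqP => /corner_slack_eq0 H; exact/nz/H.
have nup : \forall w \near z, 0 < - corner_slack p q w.
  by apply: near_gt0 => // x; apply: cvgN; exact/affine_continuous/corner_slack_affine.
have ndn : \forall w \near z, 0 <= a w -> 0 <= b w -> 0 <= corner_slack p' q' w.
  have [bp'1|bp'1] := ltP 0 (b p'); last first.
    have bp'00 : b p' = 0 by lra.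
    apply: (@filterE _ (nbhs z)) => w aw bw; rewrite /corner_slack bp'00 mul0r addr0 mulr0 subr0.
    exact: mulr_ge0.
  have [aq'1|aq'1] := ltP 0 (a q'); last first.
    have aq'00 : a q' = 0 by lra.
    apply: (@filterE _ (nbhs z)) => w aw bw; rewrite /corner_slack aq'00 !mul0r add0r subr0.
    exact: mulr_ge0.
  have dnz : 0 < corner_slack p' q' z.
    by rewrite lt_neqAle dn// andbT; apply/eqP => /esym/corner_slack_eq0 H; exact/nz'/H.
  have : \forall w \near z, 0 < corner_slack p' q' w.
    by apply: near_gt0 => //; exact/affine_continuous/corner_slack_affine.
  by apply: filterS => w /ltW.
apply: filterS2 nup ndn => w upw dnw aw bw.
have {dnw} := dnw aw bw; rewrite /corner_slack => dnw.
have [cK [Kp Kp' Kq Kq'] _] := hK.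
(* the point of the inner segment on the ray of [w], or the corner itself *)
have [y [u' [y1 Ku' au' bu']]] :
    exists y u', [/\ y <= 1, K u', a u' = y * a w & b u' = y * b w].
  have [bp'1|bp'1] := ltP 0 (b p'); last first.
    by exists 0, p'; rewrite !mul0r ler01; split => //; lra.
  have [aq'1|aq'1] := ltP 0 (a q'); last first.
    by exists 0, q'; rewrite !mul0r ler01; split => //; lra.
  pose D := a q' * b w + b p' * a w.
  have D0 : 0 < D by have := mulr_gt0 aq'1 bp'1; rewrite /D; lra.
  exists (a q' * b p' / D), (bary (b p' * a w / D) p' q'); split.
  - by rewrite ler_pdivrMr// mul1r /D; lra.
  - apply: cK => //; rewrite divr_ge0 ?ler_pdivrMr ?mul1r//= ?(ltW D0) ?mulr_ge0//.
    by rewrite /D lerDr mulr_ge0.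
  - by rewrite affine_bary// ap'; field; rewrite gt_eqF.
  - by rewrite affine_bary// bq' /D; field; rewrite gt_eqF.
pose D := a q * b w + b p * a w.
have D0 : 0 <= D by rewrite addr_ge0// mulr_ge0// ltW.
(* [D = 0] only when [w] is the corner *)
move: D0; rewrite le_eqVlt => /predU1P[/esym D0|D0].
  have [] := conj (mulr_ge0 (ltW aq0) bw) (mulr_ge0 (ltW bp0) aw) => h1 h2.
  have bw0 : b w = 0.
    by apply/eqP; rewrite -(mulrI_eq0 _ (mulfI (lt0r_neq0 aq0))); apply/eqP; move: D0; rewrite /D; lra.
  have aw0 : a w = 0.
    by apply/eqP; rewrite -(mulrI_eq0 _ (mulfI (lt0r_neq0 bp0))); apply/eqP; move: D0; rewrite /D; lra.
  by suff -> : w = u' by []; apply: coord_inj; rewrite ?au' ?bu' ?aw0 ?bw0 mulr0.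
apply: (@ray_mem K (a q * b p / D) y (bary (b p * a w / D) p q) u' w) => //.
- apply: cK => //; rewrite divr_ge0 ?ler_pdivrMr ?mul1r//= ?(ltW D0) ?mulr_ge0// ?(ltW bp0)//.
  by rewrite /D lerDr mulr_ge0// ltW.
- by rewrite ler_pdivlMr// mul1r /D; move: upw; rewrite /corner_slack; lra.
- by rewrite affine_bary// ap; field; rewrite gt_eqF.
- by rewrite affine_bary// bq /D; field; rewrite gt_eqF.
Qed.

Lemma adjacent_cross : 0 <= b p' -> b p' < b p -> 0 <= a q -> a q <= a q' ->
  segment p q `&` segment p' q' !=set0.
Proof.
move=> bp' pp aq0; rewrite le_eqVlt => /predU1P[qq|qq].
  have -> : q' = q by apply: coord_inj; rewrite ?bq ?bq'.
  by exists q; split; exists 1; rewrite ?bary1 ?/= ?in_itv/= ?ler01 ?lexx//; exact: bary1.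
pose D := b p * a q' - a q * b p'.
have D0 : 0 < D by rewrite /D; nra.
(* [t] and [s] solve the linear system for the common point of the chords *)
pose t := a q' * (b p - b p') / D; pose s := a q * (b p - b p') / D.
exists (bary t p q); split.
  exists t => //; rewrite /= in_itv/= divr_ge0 ?(ltW D0)//=; last by nra.
  by rewrite ler_pdivrMr// mul1r /D; nra.
exists s; first rewrite /= in_itv/= divr_ge0 ?(ltW D0)//=; last 2 first.
- by nra.
- by rewrite -/(bary _ p' q'); apply: coord_inj; rewrite !affine_bary// ?ap ?ap' ?bq ?bq';
  rewrite /s /t /D; field; rewrite gt_eqF.
- by rewrite ler_pdivrMr// mul1r /D; nra.
Qed.

End Adjacent.

End Quadrilateral.

(** * The quadrilateral relative to its box *)

Section QuadrilateralInBox.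
Variable R : realType.
Implicit Types (p q z w : R * R) (K : set (R * R)) (a b : R * R -> R)
  (B : box R) (d : on_data R).

Lemma hull4_quad d : hull4 (quad d) (p_up d) (p_down d) (q_up d) (q_down d).
Proof.
split; first exact: convex_conv.
  by split; apply: sub_conv => /=; tauto.
by move=> C cC ? ? ? ?; apply: conv_sub => // z /= [[[]|]|] ->.
Qed.

(** The segments do not cross, so their ends come in the same order on both
    sides; either order reduces to the other one by renaming. *)
Lemma strip_nbhs a b (l : R) K p p' q q' z :
  affine a -> affine b ->
  (forall w w', a w = a w' -> b w = b w' -> w = w') ->
  0 < l -> a p = 0 -> a p' = 0 -> a q = l -> a q' = l ->
  hull4 K p p' q q' -> p <> p' -> segment p q `&` segment p' q' = set0 ->
  K z -> ~ segment p q z -> ~ segment p' q' z ->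
  \forall w \near z, 0 <= a w <= l -> K w.
Proof.
move=> aa ab inj l0 ap ap' aq aq' hK pp' X Kz nz nz'.
have [lt|lt|/esym e] := ltgtP (b p') (b p);
  last by case: pp'; apply: inj => //; rewrite ap ap'.
  have [qq|qq] := leP (b q) (b q').
    have := opposite_cross aa ab inj ap ap' aq aq' lt qq.
    by rewrite X => -[].
  exact: (hull4_nbhs_opposite aa ab inj l0 ap ap' aq aq' hK).
have [qq|qq] := leP (b q') (b q).
  have := opposite_cross aa ab inj ap' ap aq' aq lt qq.
  by rewrite setIC X => -[].
exact: (hull4_nbhs_opposite aa ab inj l0 ap' ap aq' aq (hull4_swap hK)).
Qed.

Lemma corner_nbhs a b K p p' q q' z :
  affine a -> affine b ->
  (forall w w', a w = a w' -> b w = b w' -> w = w') ->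
  a p = 0 -> a p' = 0 -> b q = 0 -> b q' = 0 ->
  0 <= b p -> 0 <= b p' -> 0 <= a q -> 0 <= a q' ->
  hull4 K p p' q q' -> p <> p' -> segment p q `&` segment p' q' = set0 ->
  K z -> ~ segment p q z -> ~ segment p' q' z ->
  \forall w \near z, 0 <= a w -> 0 <= b w -> K w.
Proof.
move=> aa ab inj ap ap' bq bq' bp bp' aq aq' hK pp' X Kz nz nz'.
have [lt|lt|/esym e] := ltgtP (b p') (b p);
  last by case: pp'; apply: inj => //; rewrite ap ap'.
  have [qq|qq] := leP (a q) (a q').
    have := adjacent_cross aa ab inj ap ap' bq bq' bp' lt aq qq.
    by rewrite X => -[].
  exact: (hull4_nbhs_adjacent aa ab inj ap ap' bq bq' hK).
have [qq|qq] := leP (a q') (a q).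
  have := adjacent_cross aa ab inj ap' ap bq' bq bp lt aq' qq.
  by rewrite setIC X => -[].
exact: (hull4_nbhs_adjacent aa ab inj ap' ap bq' bq (hull4_swap hK)).
Qed.

(** The affine function vanishing on a side of a box and nonnegative on the
    box. *)
Definition face B (s : side) : R * R -> R :=
  match s with
  | Xmin => aff 1 0 (- lo1 B)
  | Xmax => aff (- 1) 0 (hi1 B)
  | Ymin => aff 0 1 (- lo2 B)
  | Ymax => aff 0 (- 1) (hi2 B)
  end.

Definition across (s : side) :=
  match s with Xmin => Xmax | Xmax => Xmin | Ymin => Ymax | Ymax => Ymin end.

(** [face B (turn s)] is a coordinate along the side [s]. *)
Definition turn (s : side) :=
  match s with Xmin | Xmax => Ymin | Ymin | Ymax => Xmin end.

Definition width B (s : side) :=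
  match s with Xmin | Xmax => hi1 B - lo1 B | Ymin | Ymax => hi2 B - lo2 B end.

Lemma affine_face B s : affine (face B s).
Proof. by case: s; rewrite /face; do 3 eexists. Qed.

Lemma face_ge0 B s w : box_set B w -> 0 <= face B s w.
Proof.
move=> []; rewrite /= !in_itv/= => /andP[? ?] /andP[? ?].
by case: s; rewrite /face /aff; lra.
Qed.

Lemma side_box B s w : side_set B s w -> box_set B w.
Proof.
have := box_le1 B; have := box_le2 B; case: s => h1 h2 [/= e1 e2]; split => //=;
  by rewrite ?e1 ?e2 in_itv/= ?lexx ?h1 ?h2.
Qed.

Lemma face_side B s w : side_set B s w -> face B s w = 0.
Proof. by case: s => -[/= e1 e2]; rewrite /face /aff ?e1 ?e2; lra. Qed.

Lemma face_across B s w : face B (across s) w = width B s - face B s w.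
Proof. by case: s; rewrite /face /aff /width/=; lra. Qed.

Lemma face_inj B s t : s <> t -> t <> across s ->
  forall w w', face B s w = face B s w' -> face B t w = face B t w' -> w = w'.
Proof.
case: s => //; case: t => // _ _ [x y] [x' y']; rewrite /face /aff/= => h1 h2;
  by congr pair; lra.
Qed.

(** Relative to the box, the hull of four points on two sides is bounded by the
    two connecting segments alone. *)
Lemma quad_nbhs B d z : lo1 B < hi1 B -> lo2 B < hi2 B ->
  right_side d <> left_side d ->
  side_set B (right_side d) (p_up d) -> side_set B (right_side d) (p_down d) ->
  side_set B (left_side d) (q_up d) -> side_set B (left_side d) (q_down d) ->
  p_up d <> p_down d -> l_up d `&` l_down d = set0 ->
  quad d z -> ~ l_up d z -> ~ l_down d z ->
  \forall w \near z, box_set B w -> quad d w.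
Proof.
move=> B1 B2 rl pu pd qu qd pp X Kz nz nz'.
set r := right_side d in rl pu pd; set s := left_side d in rl qu qd.
have hK := hull4_quad d.
have [e|ne] := pselect (s = across r).
  have w0 : 0 < width B r by case: (r); rewrite /width subr_gt0.
  have fq w : side_set B s w -> face B r w = width B r.
    by move=> /face_side; rewrite e face_across => /eqP; rewrite subr_eq0 => /eqP.
  have inj := @face_inj B r (turn r).
  have {}inj : forall w w', face B r w = face B r w' ->
      face B (turn r) w = face B (turn r) w' -> w = w'.
    by apply: inj; case: (r).
  have := strip_nbhs (affine_face B r) (affine_face B (turn r)) inj w0
    (face_side pu) (face_side pd) (fq _ qu) (fq _ qd) hK pp X Kz nz nz'.
  apply: filterS => w H Bw; apply: H; rewrite (face_ge0 r Bw)/= -subr_ge0.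
  by rewrite -face_across; exact: face_ge0.
have := corner_nbhs (affine_face B r) (affine_face B s) (face_inj rl ne)
  (face_side pu) (face_side pd) (face_side qu) (face_side qd)
  (face_ge0 s (side_box pu)) (face_ge0 s (side_box pd))
  (face_ge0 r (side_box qu)) (face_ge0 r (side_box qd)) hK pp X Kz nz nz'.
by apply: filterS => w H Bw; apply: H; exact: face_ge0.
Qed.

End QuadrilateralInBox.

(** * Absence of zeros outside the quadrilateral *)

Section OnBox.
Variable R : realType.
Implicit Types (p q z w c : R * R) (S G : set (R * R)) (f : R * R -> R)
  (H : {poly {poly R}}) (h : R) (B : box R) (d : on_data R).

Lemma convex_side B s : convex2 (side_set B s).
Proof.
have := box_le1 B; have := box_le2 B.
by case: s => h2 h1 p q t [/= e1 e2] [/= e1' e2'] /andP[t0 t1]; split => /=;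
  rewrite /= ?in_itv/= in e1 e2 e1' e2' *; rewrite ?e1 ?e2 ?e1' ?e2'; try ring;
  apply/andP; split; nra.
Qed.

Lemma box_face0 B s w : box_set B w -> face B s w = 0 -> side_set B s w.
Proof.
by case: s; rewrite /face /aff => -[/= w1 w2] e; split => //=; lra.
Qed.

(** The open box, also when it is empty: all that matters is that points off the
    sides are interior points. *)
Lemma open_box_interior B : exists2 O : set (R * R), open O &
  O `<=` box_set B /\
  forall w, box_set B w -> (forall s, ~ side_set B s w) -> O w.
Proof.
have oface s : open (face B s @^-1` [set x | 0 < x]).
  apply: open_comp => [z _|]; last exact: open_gt.
  exact/affine_continuous/affine_face.
exists ((face B Xmin @^-1` [set x | 0 < x] `&` face B Xmax @^-1` [set x | 0 < x]) `&`
  (face B Ymin @^-1` [set x | 0 < x] `&` face B Ymax @^-1` [set x | 0 < x])).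
  by apply: openI; apply: openI; exact: oface.
split=> [w [[]]|w Bw nw].
  rewrite /face /aff/= => h1 h2 [h3 h4].
  by split; rewrite /= in_itv/=; apply/andP; split; lra.
have pos s : 0 < face B s w.
  rewrite lt_neqAle face_ge0// andbT eq_sym; apply/eqP => fw.
  exact/(nw s)/box_face0.
by split; split; exact: pos.
Qed.

Lemma level_connected_subset G O S : connected G -> open O ->
  G `&` S = G `&` O -> G `&` closure S `<=` S -> G `&` S !=set0 -> G `<=` S.
Proof.
move=> cG oO SO GS S0.
have <- : G `&` S = G; last by move=> z [].
apply: cG => //; first by exists O.
exists (closure S); first exact: closed_closure.
apply/seteqP; split=> z [Gz Sz]; split => //; first exact: subset_closure.
exact: GS.
Qed.

Lemma segment_zero f p q : continuous f -> f p * f q < 0 ->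
  exists2 t, 0 <= t <= 1 & f (bary t p q) = 0.
Proof.
move=> cf pq; apply: segment_IVT => //.
rewrite ge_min le_max.
have [p0|p0|p0] := ltgtP (f p) 0.
- have -> : 0 <= f q by nra.
  by rewrite orbT.
- have -> : f q <= 0 by nra.
  by rewrite orbT.
- by move: pq; rewrite p0 mul0r ltxx.
Qed.

Lemma sgr_opp_mul (x y : R) : x != 0 -> Num.sg x = - Num.sg y -> x * y < 0.
Proof.
move=> x0 e; have y0 : y != 0.
  by apply: contra_neq x0 => y0; apply/eqP; rewrite -sgr_eq0 e y0 sgr0 oppr0.
rewrite -sgr_lt0 sgrM e mulNr oppr_lt0 -expr2 -sgrX sgr_gt0.
by rewrite exprn_even_gt0// y0 orbT.
Qed.

Section Zeros.
Variables (H : {poly {poly R}}) (h : R) (G : set (R * R)) (B0 B : box R)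
  (d : on_data R).
Hypotheses (G_connected : connected G)
  (G_level : forall z, box_set B0 z -> ev H z = h <-> G z)
  (BB0 : box_set B `<=` box_set B0)
  (B1 : lo1 B < hi1 B) (B2 : lo2 B < hi2 B)
  (vd : valid_on H h B d) (c1 : cond_signs H h d) (c2 : cond_segments H h d)
  (c3 : cond_other_sides G B d).

Let f z := ev H z - h.

Let f_continuous : continuous f.
Proof. by move=> z; apply: cvgB; [exact: continuous_ev|exact: cvg_cst]. Qed.

Lemma end_mem_segment p q : segment p q p /\ segment p q q.
Proof.
split; [exists 0|exists 1]; rewrite /= ?in_itv/= ?lexx ?ler01//.
- exact: bary0.
- exact: bary1.
Qed.

Lemma segments_nonzero z : l_up d z \/ l_down d z -> f z <> 0.
Proof. by case: c2 => n1 n2 [lz|lz] fz; [apply: n1|apply: n2]; exists z. Qed.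

Let sign_p : f (p_up d) * f (p_down d) < 0.
Proof.
apply: sgr_opp_mul; last by case: c1 => e1 e2 _; rewrite /f e1 e2.
by apply/eqP/segments_nonzero; left; exact: (end_mem_segment _ _).1.
Qed.

Let sign_q : f (q_up d) * f (q_down d) < 0.
Proof.
apply: sgr_opp_mul; last by case: c1 => _ e2 e3; rewrite /f e2 e3.
by apply/eqP/segments_nonzero; left; exact: (end_mem_segment _ _).2.
Qed.

Lemma p_up_neq_p_down : p_up d <> p_down d.
Proof. by move=> e; move: sign_p; rewrite e ltNge -expr2 sqr_ge0. Qed.

(** The sign change puts the only zero of each of the two distinguished sides
    between the two marked points, hence in the quadrilateral. *)
Lemma right_zero_quad :
  exists2 z, side_set B (right_side d) z /\ f z = 0 & quad d z.
Proof.
have [t t01 ft] := segment_zero f_continuous sign_p.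
have hK := hull4_quad d; have [_ [Kp Kp' _ _] _] := hK.
exists (bary t (p_up d) (p_down d)); last exact: (hull4_segment hK).
split => //; apply: convex_side => //.
- by case: (on_p_up vd).
- by case: (on_p_down vd).
Qed.

Lemma left_zero_quad :
  exists2 z, side_set B (left_side d) z /\ f z = 0 & quad d z.
Proof.
have [t t01 ft] := segment_zero f_continuous sign_q.
have hK := hull4_quad d; have [_ [_ _ Kq Kq'] _] := hK.
exists (bary t (q_up d) (q_down d)); last exact: (hull4_segment hK).
split => //; apply: convex_side => //.
- by case: (on_q_up vd).
- by case: (on_q_down vd).
Qed.

(** A point of the oval on a distinguished side is the unique zero there, and
    the other sides do not meet the oval. *)
Lemma side_zero_quad z s : side_set B s z -> G z -> quad d z.
Proof.
move=> sz Gz; have fz : f z = 0.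
  by apply/eqP; rewrite subr_eq0; apply/eqP/G_level => //; exact/BB0/(side_box sz).
have [es|ns] := pselect (s = right_side d).
  have [y yz yK] := right_zero_quad; have [x [_ ux]] := on_right vd.
  suff -> : z = y by []; rewrite -(ux z); last by rewrite -es.
  by rewrite -(ux y).
have [et|nt] := pselect (s = left_side d).
  have [y yz yK] := left_zero_quad; have [x [_ ux]] := on_left vd.
  suff -> : z = y by []; rewrite -(ux z); last by rewrite -et.
  by rewrite -(ux y).
by have : (G `&` side_set B s) z by []; rewrite (c3 ns nt).
Qed.

(** The part of the oval in the box but outside the quadrilateral is both open
    and closed in the oval, and misses the zero on the right side. *)
Lemma no_zero_outside_quad z : box_set B z -> ~ quad d z -> ev H z <> h.
Proof.
move=> Bz nz Hz; pose E := box_set B `\` quad d.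
have [V oV [VB BV]] := open_box_interior B.
have cK := compact_plane_closed (@compact_quad _ d).
have GE : G `<=` E.
  apply: (@level_connected_subset G (V `&` ~` quad d) E) => //.
  - by apply: openI => //; exact: closed_openC.
  - apply/seteqP; split=> w [Gw]; last by move=> [Vw nw]; split => //; split => //; exact: VB.
    move=> [Bw nw]; split => //; split => //; apply: BV => // s sw.
    exact: (nw (side_zero_quad sw Gw)).
  - move=> w [Gw Ew].
    have Bw : box_set B w.
      apply: (compact_plane_closed (@compact_box _ B)).
      by move: Ew; apply: closure_subset => x [].
    split => // Kw.
    have fw : f w = 0.
      by apply/eqP; rewrite subr_eq0; apply/eqP/G_level => //; exact: BB0.
    have nl : ~ l_up d w by move=> lw; apply: (@segments_nonzero w) => //; left.
    have nl' : ~ l_down d w by move=> lw; apply: (@segments_nonzero w) => //; right.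
    have := quad_nbhs B1 B2 (on_sides vd) (on_p_up vd).1 (on_p_down vd).1
      (on_q_up vd).1 (on_q_down vd).1 p_up_neq_p_down (on_no_cross vd) Kw nl nl'.
    by move=> /Ew[x [[Bx nx] /(_ Bx)]].
  - by exists z; split; [apply/G_level => //; exact: BB0|].
have [y [sy fy] Ky] := right_zero_quad.
have Gy : G y.
  apply/G_level; first exact/BB0/(side_box sy).
  by apply/eqP; rewrite -subr_eq0; apply/eqP.
by have [] := GE y Gy.
Qed.

End Zeros.

(** By the intermediate value property, the sign is constant on the connected
    component, and it passes weakly to the closure. *)
Lemma component_sign f S T z c : continuous f ->
  (forall w, S w -> f w <> 0) -> T `<=` closure (connected_component S z) ->
  T c -> f c < 0 -> forall w, T w -> f w <= 0.
Proof.
move=> cf nz TC Tc fc; set C := connected_component S z in TC.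
have open_lt0 : nbhs c (f @^-1` [set x | x < 0]).
  by apply: open_nbhs_nbhs; split => //; apply: open_comp => //; exact: open_lt.
have [u [Cu fu]] := TC c Tc _ open_lt0.
have fC : connected (f @` C).
  apply: connected_continuous_connected; first exact: component_connected.
  exact: continuous_subspaceT.
have neg x : C x -> f x <= 0.
  move=> Cx; rewrite leNgt; apply/negP => fx.
  have iC : is_interval (f @` C) by apply/connected_intervalP.
  have [y Cy] : (f @` C) 0.
    apply: (iC (f u) (f x)); [by exists u|by exists x|].
    by rewrite (ltW fx) andbT ltW.
  by apply: nz; exact: connected_component_sub Cy.
move=> w Tw; have cl : closed (f @^-1` [set x | x <= 0]).
  by apply: closed_comp => //; exact: closed_le.
by apply: cl; apply: closure_subset (TC w Tw).
Qed.

End OnBox.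

(** * Contributions of the boxes *)

Section Assembly.
Variable R : realType.
Implicit Types (p q z w c : R * R) (S T G : set (R * R)) (B : box R)
  (d : on_data R) (X Y : set R).

Notation mu := (@leb2 R).

Lemma iadd_mem X Y x y : X x -> Y y -> iadd X Y (x + y).
Proof. by move=> Xx Yy; exists x => //; exists y. Qed.

Lemma big_iadd_mem (I : finType) (P : pred I) (X : I -> set R) (x : I -> R) :
  (forall i, P i -> X i (x i)) ->
  (\big[@iadd R/[set 0]]_(i | P i) X i) (\sum_(i | P i) x i).
Proof.
by move=> Xx; elim/big_ind2 : _ => // Y y Z z; exact: iadd_mem.
Qed.

Section Oval.
Variables (H : {poly {poly R}}) (h : R) (G : set (R * R)) (B0 : box R).
Hypotheses (ovalG : is_oval H h G) (trap : trapping_box H h G B0).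

Let D : set (plane R) := [set z | ev H z < h].

Lemma oval_connected : connected G.
Proof. by case: ovalG => [[z _ ->] _ _]; exact: component_connected. Qed.

Lemma oval_level z : box_set B0 z -> ev H z = h <-> G z.
Proof. by move=> Bz; case: trap => _ /(_ z Bz)[]. Qed.

Lemma interiorE : oval_interior G = box_set B0 `&` D.
Proof.
case: trap => GB Hz; apply/seteqP; split=> z.
  move=> Gz; have Bz : box_set B0 z by apply: GB; right.
  by split => //; have [HD _ _] := Hz z Bz; exact/HD.
by move=> [Bz Dz]; have [HD _ _] := Hz z Bz; exact/HD.
Qed.

(** Were [H] constantly [h], the oval would be the whole plane, which no box
    contains. *)
Lemma level_poly_neq0 : H - (h%:P)%:P != 0.
Proof.
apply/eqP => /eqP; rewrite subr_eq0 => /eqP HE.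
case: ovalG => [[z Hz GE] _ _]; case: trap => GB _.
pose w : R * R := (hi1 B0 + 1, 0).
have : G w.
  rewrite GE; pose C := (fun t : R => bary t z w) @` `[0, 1].
  have Cc : connected C.
    apply: connected_continuous_connected; first exact: segment_connected.
    have cid : continuous (fun u : R * R => u) by move=> u; exact: cvg_id.
    apply: continuous_subspaceT; apply: continuous_plane.
    + by apply: (@continuous_along_segment _ fst) => u; exact: cvg_fst.
    + by apply: (@continuous_along_segment _ snd) => u; exact: cvg_snd.
  apply: (connected_component_max _ _ Cc).
  - by exists 0; rewrite ?bary0//= in_itv/= lexx ler01.
  - by move=> u _; rewrite /level_set/= /ev HE !hornerE.
  - by exists 1; rewrite ?bary1//= in_itv/= lexx ler01.
move=> Gw; have [] : box_set B0 w by apply: GB; left.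
by rewrite /= in_itv/= => /andP[_]; rewrite gerDl ler10.
Qed.

Lemma level_null : leb2 (level_set H h) = 0%E.
Proof.
rewrite -(zero_set_null level_poly_neq0); congr leb2.
by apply/seteqP; split => z /=; rewrite /level_set/= /ev !hornerE => /eqP;
  rewrite ?subr_eq0 => /eqP e; rewrite ?e ?subrr.
Qed.

Lemma level_measurable : measurable (level_set H h : set (plane R)).
Proof.
apply: closed_measurable_plane.
by apply: (@closed_comp _ _ (ev H) [set h]) => [z _|]; [exact: continuous_ev|exact: closed_eq].
Qed.

Lemma sublevel_measurable : measurable D.
Proof.
apply: open_measurable_plane.
by apply: (@open_comp _ _ (ev H) [set x | x < h]) => [z _|]; [exact: continuous_ev|exact: open_lt].
Qed.

Variables (i j : nat).
Let m : plane R -> R := @monomial R i j.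

Lemma monomial_integrable S B : measurable (S : set (plane R)) -> S `<=` box_set B ->
  mu.-integrable S (EFin \o m).
Proof. exact/continuous_integrable/continuous_monomial. Qed.

Lemma null_integral S B : measurable (S : set (plane R)) -> S `<=` box_set B ->
  leb2 S = 0%E -> \int[mu]_(z in S) m z = 0.
Proof.
move=> mS SB S0; apply: Rintegral_null => //.
by apply: (measurable_funS measurableT _
  (continuous_measurable_plane (@continuous_monomial R i j))).
Qed.

Lemma subset_null S T : measurable (S : set (plane R)) -> measurable (T : set (plane R)) ->
  S `<=` T -> leb2 T = 0%E -> leb2 S = 0%E.
Proof.
move=> mS mT ST T0; apply/eqP; rewrite eq_le measure_ge0 andbT -T0.
by apply: le_measure => //; exact: mem_set.
Qed.

(** Up to the null level set, a piece lies on the side of the oval given by its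
    label: the label fixes the sign at one point, and [component_sign] spreads
    it. Null pieces are allowed, as they occur when the box is degenerate or is
    filled by the quadrilateral. *)
Lemma piece_integral B T c inside :
  compact T -> T `<=` box_set B ->
  valid_piece_label H h T c inside ->
  leb2 T = 0%E \/ (exists S z, (forall w, S w -> ev H w <> h) /\
    T `<=` closure (connected_component S z)) ->
  \int[mu]_(z in T `&` D) m z = if inside then \int[mu]_(z in T) m z else 0.
Proof.
move=> cT TB [Tc lc].
have mT := compact_plane_measurable cT.
have mTD : measurable (T `&` D) by apply: measurableI => //; exact: sublevel_measurable.
have TDB : T `&` D `<=` box_set B by move=> z [/TB].
move=> [T0|[S [z [nS TS]]]].
  rewrite (null_integral mT TB T0) if_same.
  apply: (null_integral mTD TDB).
  by apply: subset_null T0 => // w [].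
have cH : continuous (fun w => ev H w - h).
  by move=> w; apply: cvgB; [exact: continuous_ev|exact: cvg_cst].
have cH' : continuous (fun w => h - ev H w).
  by move=> w; apply: cvgB; [exact: cvg_cst|exact: continuous_ev].
case: inside lc => lc.
  have neg w : T w -> ev H w <= h.
    move=> Tw; rewrite -subr_le0.
    apply: (component_sign cH _ TS Tc) => //; last by rewrite subr_lt0.
    by move=> u /nS ? /eqP; rewrite subr_eq0 => /eqP.
  rewrite [RHS](@Rintegral_setDnull _ T (level_set H h))//.
  - congr Rintegral; apply/seteqP; split=> w [Tw].
      by rewrite /D/= => Dw; split => // ew; move: Dw; rewrite ew ltxx.
    move=> /= nw; split => //; rewrite /D/= lt_neqAle neg// andbT.
    exact/eqP.
  - exact: level_measurable.
  - exact: monomial_integrable TB.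
  - exact: level_null.
have pos w : T w -> h <= ev H w.
  move=> Tw; rewrite -subr_le0.
  apply: (component_sign cH' _ TS Tc) => //; last by rewrite subr_lt0.
  by move=> u /nS ? /eqP; rewrite subr_eq0 => /eqP/esym.
have -> : T `&` D = set0.
  by apply/seteqP; split => // w [Tw]; rewrite /D/= ltNge pos.
exact: Rintegral_set0.
Qed.

(** The triangles and the boxes of the splitting are either in [D] or disjoint
    from it up to a null set; only the part of the quadrilateral in [D] is
    unknown. *)
Lemma on_enclosure B d : box_set B `<=` box_set B0 ->
  valid_on H h B d -> cond_signs H h d -> cond_segments H h d ->
  cond_other_sides G B d ->
  exists x y w : R, [/\
    \int[mu]_(z in box_set B `&` D) m z = x + y + w,
    (\big[@iadd R/[set 0]]_(e : bool | sub_inside d e) [set J i j (sub d e)]) x,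
    (\big[@iadd R/[set 0]]_(e : bool | tri_inside d e)
        bbox_term i j (tri_set (tri d e))) y &
    hull0 (bbox_term i j (quad d)) w].
Proof.
move=> BB0 vd c1 c2 c3.
have [tS uS cS] := on_split vd.
set pieces := quad d :: split_pieces d in tS uS cS.
have piecesB k : (k < 5)%N -> nth set0 pieces k `<=` box_set B.
  by move=> k5 z kz; rewrite -uS; exists k.
have cQ := @compact_quad _ d.
have cT e := @compact_tri _ (tri d e).
have cX e := @compact_box _ (sub d e).
have piece_ok k c l : (k < 4)%N -> compact (nth set0 (split_pieces d) k) ->
    convex2 (nth set0 (split_pieces d) k) ->
    valid_piece_label H h (nth set0 (split_pieces d) k) c l ->
    \int[mu]_(z in nth set0 (split_pieces d) k `&` D) m z =
    if l then \int[mu]_(z in nth set0 (split_pieces d) k) m z else 0.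
  move=> k4; set T := nth _ _ k => coT cvT lT.
  have TB : T `<=` box_set B by exact: (piecesB k.+1).
  have mT := compact_plane_measurable coT.
  apply: (piece_integral coT TB lT).
  have [[B1 B2]|deg] := pselect (lo1 B < hi1 B /\ lo2 B < hi2 B); last first.
    (* a degenerate box has area [0] *)
    left; apply: subset_null TB _ => //; first exact: measurable_box.
    rewrite leb2_box; congr EFin; apply/eqP; rewrite mulf_eq0 !subr_eq0.
    move: (box_le1 B) (box_le2 B); rewrite !le_eqVlt => /orP[/eqP ->|b1].
      by rewrite eqxx.
    move=> /orP[/eqP ->|b2]; first by rewrite eqxx orbT.
    by case: deg.
  have [[z BPz]|BP0] := pselect (box_set B `\` quad d !=set0); last first.
    (* the interiors of the pieces avoid that of the quadrilateral, which is the
       whole box *)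
    left; suff T0 : T° = set0 by rewrite -(convex_boundary_null cvT mT) T0 setD0.
    apply/seteqP; split => // w Tw.
    have qw : (quad d)° w.
      apply: interiorS Tw => x /TB Bx; apply: contrapT => nq; apply: BP0.
      by exists x.
    by have := tS 0%N k.+1 isT k4 (ex_intro _ w (conj qw Tw)).
  right; exists (box_set B `\` quad d).
  have [_ /(_ k k4)[y By Ty]] := cS (ex_intro _ z BPz).
  exists y; split => // w [Bw nw].
  exact: (no_zero_outside_quad oval_connected oval_level BB0 B1 B2 vd c1 c2 c3).
pose S (k : 'I_5) : set (R * R) := nth set0 pieces k.
have cvS k : (k < 5)%N -> convex2 (nth set0 pieces k).
  by case: k => [|[|[|[|[|//]]]]] _ /=; (exact: convex_conv || exact: convex_box).
have coS k : (k < 5)%N -> compact (nth set0 pieces k).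
  case: k => [|[|[|[|[|//]]]]] _; [exact: cQ|exact: cT|exact: cT|exact: cX|exact: cX].
have US : \bigcup_k S k = box_set B.
  rewrite -uS; apply/seteqP; split=> z; first by move=> [k _ Sz]; exists k => /=.
  by move=> [k /= k5 kz]; exists (Ordinal k5).
have mS (k : 'I_5) : measurable (S k : set (plane R)).
  exact: (compact_plane_measurable (coS _ (ltn_ord k))).
have tiles : \int[mu]_(z in box_set B `&` D) m z =
    \sum_(k < 5) \int[mu]_(z in S k `&` D) m z.
  rewrite -US; apply: Rintegral_tiles => //.
  - by move=> k; apply: convex_boundary_null => //; exact: cvS.
  - move=> k l _ _ H0; apply/val_inj; exact: (tS k l (ltn_ord k) (ltn_ord l) H0).
  - exact: sublevel_measurable.
  - rewrite US; apply: (@monomial_integrable _ B) => [|z []//].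
    by apply: measurableI; [exact: measurable_box|exact: sublevel_measurable].
exists (\sum_(e : bool | sub_inside d e) J i j (sub d e)),
  (\sum_(e : bool | tri_inside d e) \int[mu]_(z in tri_set (tri d e)) m z),
  (\int[mu]_(z in quad d `&` D) m z); split.
- rewrite tiles !big_ord_recl big_ord0 addr0 /S/=.
  rewrite (piece_ok 0%N _ _ isT (coS 1%N isT) (cvS 1%N isT) (on_tri_label vd false)).
  rewrite (piece_ok 1%N _ _ isT (coS 2%N isT) (cvS 2%N isT) (on_tri_label vd true)).
  rewrite (piece_ok 2%N _ _ isT (coS 3%N isT) (cvS 3%N isT) (on_sub_label vd false)).
  rewrite (piece_ok 3%N _ _ isT (coS 4%N isT) (cvS 4%N isT) (on_sub_label vd true)).
  rewrite /= !Rintegral_monomial [in RHS]big_mkcond big_bool/=.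
  rewrite [in RHS]big_mkcond big_bool/=.
  have regroup (q a b c e : R) : q + (a + (b + (c + e))) = e + c + (b + a) + q.
    by ring.
  exact: regroup.
- exact: big_iadd_mem.
- apply: big_iadd_mem => e _; apply: (@bbox_term_Rintegral _ _ _ _ B).
  + exact: convex_conv.
  + exact: cT.
  + by have [Te _] := on_tri_label vd e; exists (tri_point d e).
  + by case: e; [exact: (piecesB 2%N)|exact: (piecesB 1%N)].
- apply: (@hull0_bbox_term_Rintegral _ _ _ _ _ B) => //.
  + by exists (p_up d); apply: sub_conv; left; left; left.
  + exact: (piecesB 0%N).
  + by apply: measurableI; [exact: compact_plane_measurable|exact: sublevel_measurable].
Qed.

(** The four components of [t] are the shares of the box in the four sums of the
    enclosure. *)
Lemma box_enclosure B (lb : label R) : box_set B `<=` box_set B0 ->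
  valid_label H h B lb ->
  (forall d, lb = On d -> [/\ cond_signs H h d, cond_segments H h d &
     cond_other_sides G B d]) ->
  exists t : R * R * R * R, [/\
    \int[mu]_(z in box_set B `&` D) m z = t.1.1.1 + t.1.1.2 + t.1.2 + t.2,
    match lb with
    | Inside => [set J i j B]
    | On d => \big[@iadd R/[set 0]]_(e : bool | sub_inside d e)
                [set J i j (sub d e)]
    | _ => [set 0]
    end t.1.1.1,
    (if lb is On d then
      \big[@iadd R/[set 0]]_(e : bool | tri_inside d e)
        bbox_term i j (tri_set (tri d e))
     else [set 0]) t.1.1.2,
    (if lb is Fail then hull0 (Jt i j B) else [set 0]) t.1.2 &
    (if lb is On d then hull0 (bbox_term i j (quad d)) else [set 0]) t.2].
Proof.
move=> BB0; case: lb => [Bin _|Bout _|d vd /(_ d erefl)[c1 c2 c3]|_ _].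
- exists (J i j B, 0, 0, 0); split => //=; rewrite !addr0 -Rintegral_monomial.
  by congr Rintegral; apply/seteqP; split=> [z []//|z Bz]; split => //; exact: Bin.
- exists (0, 0, 0, 0); split => //=; rewrite !addr0.
  have -> : box_set B `&` D = set0; last exact: Rintegral_set0.
  by apply/seteqP; split => // z [/Bout Hz]; rewrite /D/= ltNge ltW.
- have [x [y [w [-> xP yP wP]]]] := on_enclosure BB0 vd c1 c2 c3.
  by exists (x, y, 0, w); split => //=; rewrite addr0.
- exists (0, 0, \int[mu]_(z in box_set B `&` D) m z, 0); split => //=.
    by rewrite !add0r addr0.
  apply: hull0_Jt_Rintegral => [|z []//].
  by apply: measurableI; [exact: measurable_box|exact: sublevel_measurable].
Qed.

Lemma subdivision_integral n (B : 'I_n -> box R) : subdivision B0 B ->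
  abelian_integral i j G = \sum_(k < n) \int[mu]_(z in box_set (B k) `&` D) m z.
Proof.
move=> [U tB]; rewrite /abelian_integral interiorE -U.
apply: (@Rintegral_tiles _ _ (fun k => box_set (B k))) => //.
- by move=> k; exact: measurable_box.
- move=> k; apply: convex_boundary_null; first exact: convex_box.
  exact: measurable_box.
- exact: sublevel_measurable.
- rewrite U; apply: (@monomial_integrable _ B0) => [|z []//].
  by apply: measurableI; [exact: measurable_box|exact: sublevel_measurable].
Qed.

End Oval.

End Assembly.

Theorem theorem3p4 (R : realType) (H : {poly {poly R}}) (h : R) (i j : nat)
  (Gam : set (R * R)) (B0 : box R)
  (n : nat) (B : 'I_n -> box R) (lab : 'I_n -> label R)
  (oval : is_oval H h Gam)
  (trapping : trapping_box H h Gam B0)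
  (subdiv : subdivision B0 B)
  (labels : forall k : 'I_n, valid_label H h (B k) (lab k))
  (hyp1 : forall (k : 'I_n) (d : on_data R), lab k = On d ->
     cond_signs H h d)
  (hyp2 : forall (k : 'I_n) (d : on_data R), lab k = On d ->
     cond_segments H h d)
  (hyp3 : forall (k : 'I_n) (d : on_data R), lab k = On d ->
     cond_other_sides Gam (B k) d) :
  iadd (iadd (iadd (sum_boxes i j B lab) (sum_triangles i j lab))
             (sum_fail i j B lab))
       (sum_on i j lab)
    (abelian_integral i j Gam).
Proof.
have [U _] := subdiv.
have BB0 k : box_set (B k) `<=` box_set B0 by rewrite -U => z Bz; exists k.
have /choice[t tP] : forall k, exists t, _ :=
  fun k => box_enclosure oval trapping i j (BB0 k) (labels k)
    (fun d e => And3 (hyp1 k d e) (hyp2 k d e) (hyp3 k d e)).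
rewrite (subdivision_integral trapping i j subdiv).
under eq_bigr => k _ do have [-> _ _ _ _] := tP k.
rewrite !big_split; apply: iadd_mem; [apply: iadd_mem; [apply: iadd_mem|]|].
- by apply: big_iadd_mem => k _; have [] := tP k.
- by apply: big_iadd_mem => k _; have [] := tP k.
- by apply: big_iadd_mem => k _; have [] := tP k.
- by apply: big_iadd_mem => k _; have [] := tP k.
Qed.
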